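(* Let $\mathbb P$ be a probability measure on $\Omega_+$ under which $(\omega(x))_{x\ge0}$ is stationary and ergodic. Then $P_0$-a.s. \[\lim_{n\to\infty}\frac{X_n}{n}=v:=\frac1u\ge0,\qquad u:=\sum_{j\ge1}P_0[T_{j+1}-T_j\ge j]\in[1,\infty],\] with the convention $1/\infty=0$.
   Context: Cookie environments: $\Omega_+=([1/2,1]^{\mathbb N})^{\mathbb Z}$, $\omega(x)=(\omega(x,i))_{i\ge1}$. $P_{x,\omega}$ is the law of the nearest-neighbor process $(X_n)_{n\ge0}$ with $X_0=x$ which, on its $i$-th visit to site $z$, jumps to $z+1$ with probability $\omega(z,i)$ and to $z-1$ otherwise. Annealed measure $P_x[\cdot]=\mathbb E[P_{x,\omega}[\cdot]]$. $T_k=\inf\{n\ge0:X_n=k\}$. *)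

(* Defs.v *)
From HB Require Import structures.
From mathcomp Require Import all_boot all_order all_algebra.
From mathcomp Require Import all_classical all_reals all_analysis.
Set Implicit Arguments. Unset Strict Implicit. Unset Printing Implicit Defensive.
Import Order.TTheory GRing.Theory Num.Theory.
Local Open Scope classical_set_scope.
Local Open Scope ring_scope.

(* An environment is a map (site z : int, visit number i : nat) |-> omega(z,i).
   Only the visit numbers i >= 1 are used. *)
Definition env (R : Type) := int -> nat -> R.

Definition cyl_gen (R : realType) (I : Type) : set_system (I -> nat -> R) :=
  [set A | exists (x : I) (i : nat) (B : set R),
      measurable B /\ A = (fun s => s x i) @^-1` B].
Definition cyl_measurable (R : realType) (I : Type) : set_system (I -> nat -> R) :=
  <<s @cyl_gen R I >>.

Definition proj_nonneg (R : Type) (w : env R) : nat -> nat -> R :=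
  fun x i => w (Posz x) i.
Definition seq_shift (R : Type) (s : nat -> nat -> R) : nat -> nat -> R :=
  fun x i => s x.+1 i.

(* The cookie walk driven by the environment w and a sequence U of [0,1]-valued
   numbers: path w U n = [:: X_n; X_{n-1}; ...; X_0], X_0 = 0, and
   X_{n+1} = X_n + 1 iff U n < w X_n k, where k = #{m <= n : X_m = X_n}
   (the current visit is the k-th visit to X_n).  If U n is uniform on [0,1]
   and independent of the past, the step is +1 with probability w X_n k. *)
Fixpoint cpath (R : realType) (w : env R) (U : nat -> R) (n : nat) : seq int :=
  match n with
  | 0 => [:: 0]
  | n'.+1 =>
      let p := cpath w U n' in
      let x := head 0 p in
      let k := count (pred1 x) p in
      (if U n' < w x k then x + 1 else x - 1) :: p
  end.
Definition cwalk (R : realType) (w : env R) (U : nat -> R) (n : nat) : int :=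
  head 0 (cpath w U n).

(* The event {T_{j+1} - T_j >= j}, T_k = inf{n : X_n = k}: every visit time n
   of j+1 satisfies T_j + j <= n (vacuous if T_{j+1} = oo). *)
Definition gap_event (X : nat -> int) (j : nat) : Prop :=
  forall n, X n = (j.+1)%:Z -> exists m, X m = j%:Z /\ (m + j <= n)%N.

(* Main.v *)
Require Import Defs.
From HB Require Import structures.
From mathcomp Require Import all_boot all_order all_algebra.
From mathcomp Require Import all_classical all_reals all_analysis.
From mathcomp Require Import measurable_realfun ring lra zify.
Set Implicit Arguments. Unset Strict Implicit. Unset Printing Implicit Defensive.
Import Order.TTheory GRing.Theory Num.Theory numFieldNormedType.Exports.
Local Open Scope classical_set_scope.
Local Open Scope ring_scope.

(* Attach to every site z a stack of arrows, the i-th of which points to the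
   right with probability omega(z,i), and let the walk follow at each visit of
   z the next arrow; this does not change its law. The numbers of departures
   from the sites before T_j are then determined, from j downwards, by flow
   conservation across the edges, so that the departures from a site x >= 0
   depend only on the stacks between x and j. Hence the event
   {T_{j+1} - T_j >= k}, for k <= j, is the event
   L_k = {T_{k+1} - T_k >= k} read in the stacks shifted by j - k, and
   sum_{j<n} (T_{j+1} - T_j) is compared with the Birkhoff sums of
   sum_k 1_{L_k}, whose mean is u. The stacks are stationary and ergodic, which
   gives T_n / n -> u; when u is finite, Borel-Cantelli applied to the L_k makes
   the gaps T_{j+1} - T_j < j for all large j, so that the sites below 0, where
   nothing is assumed, do not matter. Since omega >= 1/2 the walk dominates a
   simple random walk, so every T_j is finite and liminf X_n / n >= 0. *)

(** * Ergodic theorem *)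

(** Stationarity is assumed only to the right of 0, so the gaps [T_{j+1} - T_j], which may depend on
    all stacks to the left of [j], do not form a stationary sequence. The substitute: in fewer than
    [k] steps from [j] the walk cannot get below [j - k], so whether the gap is shorter than [k] is
    decided inside the window [[j - k, j]], which makes it a forward-looking event at [j - k].
    Counting a gap by the [k >= 1] that it reaches gives a double sum over [i = j - k] and [k]; the
    pairs with [i < 0] are the reason why gaps exceeding [j] must be excluded. The two bounds on
    [T_n] are asymmetric. The lower one needs only a finite truncation of the series, whether or not
    [u] is finite; the upper one needs the whole series to be integrable. For infinite [u]
    backtracking must therefore be controlled by the simple random walk. Joint ergodicity of
    environment and arrows is not automatic for a product of ergodic systems; it comes from the
    independence of the arrows at different sites. *)

Section ergodic.
Context d (S : measurableType d) (R : realType) (P : probability S R).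
Variable theta : S -> S.
Hypothesis mtheta : measurable_fun setT theta.
Hypothesis theta_inv : forall A, measurable A -> P (theta @^-1` A) = P A.

Definition birk (f : S -> R) (n : nat) (s : S) : R :=
  \sum_(i < n) f (iter i theta s).

Lemma birkS f n s : birk f n.+1 s = f s + birk f n (theta s).
Proof.
rewrite /birk big_ord_recl /=; congr (_ + _).
by apply: eq_bigr => i _; rewrite -iterSr.
Qed.

Lemma measurable_iter n : measurable_fun setT (iter n theta).
Proof.
elim: n => [|n IH]; first exact: measurable_id.
exact: (measurableT_comp mtheta IH).
Qed.

Lemma measurable_birk f n : measurable_fun setT f -> measurable_fun setT (birk f n).
Proof.
move=> mf; apply: measurable_sum => i.
by apply: measurableT_comp => //; exact: measurable_iter.
Qed.

Lemma integral_theta (f : S -> \bar R) : P.-integrable setT f ->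
  P.-integrable setT (f \o theta) /\
  (\int[P]_s f (theta s) = \int[P]_s f s)%E.
Proof.
move=> intf.
have mf : measurable_fun setT f by case/integrableP : intf.
have E (h : S -> \bar R) : measurable_fun setT h -> (forall s, 0 <= h s)%E ->
    (\int[P]_s h (theta s) = \int[P]_s h s)%E.
  move=> mh h0.
  have := @ge0_integral_pushforward _ _ _ _ R theta mtheta P setT h measurableT mh.
  rewrite preimage_setT => <-; last by move=> s _; exact: h0.
  by apply: eq_measure_integral => A mA _; exact: theta_inv.
have mft : measurable_fun setT (f \o theta) by exact: measurableT_comp.
split.
  apply/integrableP; split => //=.
  rewrite (E (fun s => `|f s|%E)) //; first by case/integrableP : intf.
  exact: measurableT_comp.
rewrite [LHS]integralE [RHS]integralE.
congr (_ - _)%E.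
- rewrite (funepos_comp f theta); apply: (E (f^\+)%E); last exact: funepos_ge0.
  exact: measurable_funepos.
- rewrite (funeneg_comp f theta); apply: (E (f^\-)%E); last exact: funeneg_ge0.
  exact: measurable_funeneg.
Qed.

(** Recursive form of the maximum of [birk g m] over [m <= n]; the recursion is the identity on
    which Garsia's proof of the maximal inequality rests. *)
Fixpoint maxbirk (g : S -> R) (n : nat) : S -> R :=
  if n is m.+1 then fun s => Num.max 0 (g s + maxbirk g m (theta s))
  else fun=> 0.

Lemma maxbirk_ge0 g n s : 0 <= maxbirk g n s.
Proof. by case: n => //= n; rewrite le_max lexx. Qed.

Lemma le_maxbirkS g n s : maxbirk g n s <= maxbirk g n.+1 s.
Proof.
elim: n s => [|n IH] s; first exact: maxbirk_ge0.
have h := IH (theta s).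
change (Num.max 0 (g s + maxbirk g n (theta s)) <=
  Num.max 0 (g s + maxbirk g n.+1 (theta s))).
by rewrite ge_max !le_max lexx /= lerD2l h orbT.
Qed.

Lemma birk_le_maxbirk g n m s : (m <= n)%N -> birk g m s <= maxbirk g n s.
Proof.
elim: n m s => [|n IH] [|m] s //= mn.
- by rewrite /birk big_ord0.
- by rewrite /birk big_ord0 le_max lexx.
by rewrite birkS le_max lerD2l IH ?orbT.
Qed.

Lemma integrable_maxbirk g n : P.-integrable setT (EFin \o g) ->
  P.-integrable setT (EFin \o maxbirk g n).
Proof.
move=> ig; elim: n => [|n IH].
  apply: (eq_integrable _ (cst 0%E)) => //; exact: integrable0.
have [it _] := integral_theta IH.
have iD := integrableD measurableT ig it.
have := integrable_funepos measurableT iD.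
apply: eq_integrable => // s _.
by rewrite funeposE /= -EFinD maxC -EFin_max.
Qed.

(** Garsia's argument: where [maxbirk g n.+1] is positive, [g] equals
    [maxbirk g n.+1 - maxbirk g n \o theta]; elsewhere this difference is at most 0. By invariance
    its integral is that of [maxbirk g n.+1 - maxbirk g n], which is nonnegative. *)
Lemma maximal_ergodic g n : P.-integrable setT (EFin \o g) ->
  (0 <= \int[P]_s (g s * (0 < maxbirk g n.+1 s)%R%:R)%:E)%E.
Proof.
move=> ig.
have mM k : measurable_fun setT (maxbirk g k).
  by apply/measurable_EFinP; case/integrableP: (integrable_maxbirk k ig).
have mg : measurable_fun setT g by apply/measurable_EFinP; case/integrableP: ig.
have [it Et] := integral_theta (integrable_maxbirk n ig).
have i1 := integrable_maxbirk n.+1 ig.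
have i0 := integrable_maxbirk n ig.
have id := integrableB measurableT i1 it.
have mI : measurable_fun setT (fun s => (0 < maxbirk g n.+1 s)%R%:R : R).
  have mS : measurable [set s | 0 < maxbirk g n.+1 s].
    have := measurable_fun_ltr (measurable_cst (0:R)) (mM n.+1).
    by move=> /(_ measurableT [set true]); rewrite setTI; apply.
  rewrite (_ : (fun s => _) = \1_[set s | 0 < maxbirk g n.+1 s]).
    exact: measurable_indic.
  apply/funext => s; rewrite indicE; congr (_%:R).
  by case: (boolP (0 < maxbirk g n.+1 s)) => h; [rewrite mem_set|rewrite memNset//; exact/negP].
have ih : P.-integrable setT (fun s => (g s * (0 < maxbirk g n.+1 s)%R%:R)%:E).
  apply: (le_integrable measurableT _ _ ig).
    by apply/measurable_EFinP; exact: measurable_funM.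
  move=> s _; rewrite /= lee_fin normrM ler_piMr //.
  by case: (0 < _); rewrite ?normr1 ?normr0.
apply: (@le_trans _ _ (\int[P]_s ((EFin \o maxbirk g n.+1) \- (EFin \o maxbirk g n \o theta)) s)%E); last first.
  apply: le_integral => // s _.
  rewrite /= -EFinB lee_fin.
  have := maxbirk_ge0 g n (theta s).
  case: ltP => /=.
    rewrite lt_max ltxx /= => h _.
    by rewrite (max_idPr (ltW h)) mulr1 addrK.
  rewrite le_eqVlt ltNge le_max lexx orbF mulr0 => /eqP ->.
  by rewrite sub0r oppr_le0.
rewrite integralB_EFin //.
rewrite Et -integralB_EFin //.
by apply: integral_ge0 => s _; rewrite -EFinB lee_fin subr_ge0 le_maxbirkS.
Qed.

(** The sets where [maxbirk g n.+1] is positive exhaust the space up to a null set, so the maximal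
    inequality passes to the limit under the bound [|g|]. *)
Lemma integral_ge0_birk g : P.-integrable setT (EFin \o g) ->
  {ae P, forall s, exists n, 0 < birk g n s} -> (0 <= \int[P]_s (g s)%:E)%E.
Proof.
move=> ig aeB.
have mM k : measurable_fun setT (maxbirk g k).
  by apply/measurable_EFinP; case/integrableP: (integrable_maxbirk k ig).
have mg : measurable_fun setT g by apply/measurable_EFinP; case/integrableP: ig.
pose h (n : nat) (s : S) := (g s * (0 < maxbirk g n.+1 s)%R%:R)%:E.
have mh n : measurable_fun setT (h n).
  apply/measurable_EFinP; apply: measurable_funM => //.
  have mS : measurable [set s | 0 < maxbirk g n.+1 s].
    have := measurable_fun_ltr (measurable_cst (0:R)) (mM n.+1).
    by move=> /(_ measurableT [set true]); rewrite setTI; apply.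
  rewrite (_ : (fun s => _) = \1_[set s | 0 < maxbirk g n.+1 s]).
    exact: measurable_indic.
  apply/funext => s; rewrite indicE; congr (_%:R).
  by case: (boolP (0 < maxbirk g n.+1 s)) => hs; [rewrite mem_set|rewrite memNset//; exact/negP].
have h_le : {ae P, forall s n, setT s -> (`|h n s| <= `|(g s)%:E|)%E}.
  apply: aeW => s n _; rewrite /h lee_fin normrM ler_piMr //.
  by case: (0 < _); rewrite ?normr1 ?normr0.
have h_cvg : {ae P, forall s, setT s -> h ^~ s @ \oo --> (g s)%:E}.
  apply: filterS aeB => s [n hn] _; apply: cvg_near_cst.
  exists n => // m /= nm; rewrite /h.
  have -> : 0 < maxbirk g m.+1 s.
    by rewrite (lt_le_trans hn)// birk_le_maxbirk// ltnW.
  by rewrite mulr1.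
have ig' := integrable_abse ig.
have [_ _ cvgI] := dominated_convergence measurableT mh (iffRL (measurable_EFinP _ _) mg) h_cvg ig' h_le.
rewrite -(cvg_lim _ cvgI) //; apply: lime_ge; first by apply/cvg_ex; eexists; exact: cvgI.
by apply: nearW => n; exact: maximal_ergodic.
Qed.

Hypothesis theta_erg : forall A, measurable A -> theta @^-1` A = A ->
  P A = 0%E \/ P A = 1%E.

(** The event that the upper limit of [birk f n / n] exceeds [b]; strictness is expressed by a
    margin [1/(p+1)], so that only countable operations occur. *)
Let limsup_gt (f : S -> R) (b : R) : set S :=
  [set s | exists p : nat, forall N, exists2 n, (N <= n)%N &
     (b + p.+1%:R^-1) * n%:R < birk f n s].

Lemma measurable_limsup_gt f b : measurable_fun setT f -> measurable (limsup_gt f b).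
Proof.
move=> mf.
rewrite (_ : limsup_gt f b = \bigcup_p \bigcap_N \bigcup_(n in [set n | (N <= n)%N])
  [set s | (b + p.+1%:R^-1) * n%:R < birk f n s]); last first.
  apply/seteqP; split => s.
    by move=> [p h]; exists p => // N _; have [n Nn hn] := h N; exists n.
  by move=> [p _ h]; exists p => N; have [n Nn hn] := h N I; exists n.
apply: bigcupT_measurable => p; apply: bigcapT_measurable => N.
apply: bigcup_measurable => n _.
have := measurable_fun_ltr (measurable_cst ((b + p.+1%:R^-1) * n%:R)) (measurable_birk n mf).
by move=> /(_ measurableT [set true]); rewrite setTI; apply.
Qed.

(* Passing from [p] to [p + 1] leaves a linear gap, which absorbs the bounded
   terms produced by one shift. *)
Lemma limsup_gt_invariant f b : theta @^-1` limsup_gt f b = limsup_gt f b.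
Proof.
have gap p : 0 < p.+1%:R^-1 - p.+2%:R^-1 :> R.
  by rewrite subr_gt0 ltf_pV2 ?posrE ?ltr0n // ltr_nat.
have archi p (c : R) : exists N, forall n, (N <= n)%N ->
    c < (p.+1%:R^-1 - p.+2%:R^-1) * n%:R.
  exists (Num.Def.archi_bound (`|c| / (p.+1%:R^-1 - p.+2%:R^-1))) => n Nn.
  rewrite -ltr_pdivrMl// mulrC.
  apply: (@le_lt_trans _ _ (`|c| / (p.+1%:R^-1 - p.+2%:R^-1))).
    by rewrite ler_pM2r ?invr_gt0// ler_norm.
  apply: (lt_le_trans (archi_boundP _)); last by rewrite ler_nat.
  by rewrite divr_ge0// ltW.
apply/seteqP; split => s [p h].
  have [N0 hN0] := archi p (b + p.+2%:R^-1 - f s).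
  exists p.+1 => N; have [n nN hn] := h (maxn N N0).
  exists n.+1; first by rewrite (leq_trans _ (leqnSn n))// (leq_trans _ nN)// leq_maxl.
  rewrite birkS; have := hN0 n (leq_trans (leq_maxr _ _) nN).
  by move: hn; rewrite -[n.+1%:R]natr1; set x := p.+1%:R^-1; set y := p.+2%:R^-1; nra.
have [N0 hN0] := archi p (f s - b - p.+1%:R^-1).
exists p.+1 => N; have [[|n] nN hn] := h (maxn N N0).+1 => //.
exists n; first exact: (leq_trans (leq_maxl N N0) nN).
move: hn; rewrite birkS; have := hN0 n (leq_trans (leq_maxr N N0) nN).
by rewrite -[n.+1%:R]natr1; set x := p.+1%:R^-1; set y := p.+2%:R^-1; nra.
Qed.

(** Half of Birkhoff's theorem. For [b] between the mean and [a], the invariant event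
    [limsup_gt f b] cannot have probability 1: [f - b] would have a positive Birkhoff sum almost
    everywhere, hence a nonnegative integral. Lower bounds follow by applying this to [- f]. *)
Theorem ergodic_limsup f (a : R) : P.-integrable setT (EFin \o f) ->
  (\int[P]_s (f s)%:E < a%:E)%E ->
  {ae P, forall s, exists N, forall n, (N <= n)%N -> birk f n s <= a * n%:R}.
Proof.
move=> ifn Efa.
have mf : measurable_fun setT f by apply/measurable_EFinP; case/integrableP: ifn.
have Efin := integral_fune_fin_num measurableT ifn.
set E := (\int[P]_s _)%E in Efa Efin.
pose b := (fine E + a) / 2.
have Ea : fine E < a by rewrite -lte_fin fineK.
have [Eb ba] : fine E < b /\ b < a by rewrite /b; split; lra.
have mB := measurable_limsup_gt b mf.
have PB : P (limsup_gt f b) = 0%E.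
  have [//|PB1] := theta_erg mB (limsup_gt_invariant f b).
  have icst : P.-integrable setT (EFin \o cst b).
    exact: finite_measure_integrable_cst.
  have ig : P.-integrable setT (EFin \o (fun s => f s - b)).
    exact: (integrableB measurableT ifn icst).
  suff : (0 <= \int[P]_s (f s - b)%:E)%E.
    have -> : (\int[P]_s (f s - b)%:E)%E = (\int[P]_s ((f s)%:E - (cst b s)%:E))%E by [].
    rewrite integralB_EFin// -/E.
    rewrite [X in (_ - X)%E](_ : _ = b%:E); last first.
      by rewrite -[RHS]mule1 -(probability_setT P) -integral_cst.
    rewrite -(fineK Efin) -EFinB lee_fin subr_ge0 => h.
    by move: Eb; rewrite ltNge h.
  apply: integral_ge0_birk => //.
  exists (~` limsup_gt f b); split.
  - exact: measurableC.
  - by rewrite probability_setC// PB1 subee.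
  - move=> s /= h [p hp]; apply: h; have [n n0 hn] := hp 1%N.
    exists n; rewrite /birk sumrB sumr_const card_ord subr_gt0.
    by apply: le_lt_trans hn; rewrite -[leLHS]mulr_natr ler_wpM2r// lerDl invr_ge0.
exists (limsup_gt f b); split => // s /= hs.
exists (Num.Def.archi_bound (a - b)^-1) => N.
apply: contrapT => hN; apply: hs; exists N => n Nn.
rewrite leNgt; apply/negP => lt; apply: hN; exists n => //.
apply: le_lt_trans lt; rewrite ler_wpM2r// -lerBrDl.
rewrite -[leRHS]invrK lef_pV2 ?posrE ?invr_gt0 ?subr_gt0 ?ltr0n//.
apply: ltW; apply: (lt_trans (archi_boundP _)).
  by rewrite invr_ge0 subr_ge0 ltW.
by rewrite ltr_nat.
Qed.

End ergodic.

(** * Counting events along orbits *)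

Lemma series_gt_partial (R : realType) (a : nat -> \bar R) c :
  (forall i, 0 <= a i)%E -> (c < \sum_(i <oo) a i)%E ->
  exists K, (c < \sum_(i < K) a i)%E.
Proof.
move=> a0 h; apply: contrapT => /forallNP H; move: h; apply/negP.
rewrite -leNgt; apply: lime_le.
  by apply: is_cvg_nneseries => i _ _.
by apply: nearW => n; rewrite big_mkord leNgt; exact/negP/H.
Qed.

Section event_counts.
Context d (S : measurableType d) (R : realType) (P : probability S R).
Variable theta : S -> S.
Hypothesis mtheta : measurable_fun setT theta.
Hypothesis theta_inv : forall A, measurable A -> P (theta @^-1` A) = P A.
Hypothesis theta_erg : forall A, measurable A -> theta @^-1` A = A ->
  P A = 0%E \/ P A = 1%E.
Variable L : nat -> set S.
Hypothesis mL : forall k, measurable (L k).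

Let u : \bar R := (\sum_(1 <= k <oo) P (L k))%E.

Let count (n K : nat) (s : S) : nat :=
  (\sum_(i < n) \sum_(1 <= k < K.+1) (iter i theta s \in L k))%N.

Let uE : u = (\sum_(i <oo) P (L i.+1))%E.
Proof.
by rewrite /u -nneseries_addn//; apply: eq_eseriesr => i _; rewrite addn1.
Qed.

Let countE n K s : (count n K s)%:R =
  birk theta (fun s => \sum_(k < K) \1_(L k.+1) s : R) n s.
Proof.
rewrite natr_sum; apply: eq_bigr => i _; rewrite natr_sum big_add1 big_mkord.
by apply: eq_bigr => k _; rewrite indicE.
Qed.

Let integrable_indicL k : P.-integrable setT (EFin \o (\1_(L k) : S -> R)).
Proof. exact: integrable_indic. Qed.

(** Cut the series at a [K] whose partial sum exceeds [c]; the truncated sum is bounded, so the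
    ergodic theorem applies even when [u] is infinite. *)
Lemma ergodic_count_lower : {ae P, forall s, forall c : R, (c%:E < u)%E ->
  exists K N, forall n, (N <= n)%N -> c * n%:R <= (count n K s)%:R}.
Proof.
pose g K (s : S) : R := \sum_(k < K) \1_(L k.+1) s.
have ig K : P.-integrable setT (EFin \o g K).
  elim: K => [|K IH].
    apply: (eq_integrable _ (cst 0%E)) => //; last exact: integrable0.
    by move=> s _; rewrite /= /g big_ord0.
  have := integrableD measurableT IH (integrable_indicL K.+1).
  by apply: eq_integrable => // s _; rewrite /= /g big_ord_recr.
have Eg K : (\int[P]_s (g K s)%:E = \sum_(k < K) P (L k.+1))%E.
  under eq_integral => s _ do rewrite /g -sumEFin.
  rewrite ge0_integral_sum//; last first.
    by move=> k; apply/measurable_EFinP; exact: measurable_indic.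
  by apply: eq_bigr => k _; rewrite integral_indic// setIT.
have fE K : (\sum_(k < K) P (L k.+1) = (\sum_(k < K) fine (P (L k.+1)))%:E)%E.
  by rewrite -sumEFin; apply: eq_bigr => k _; rewrite fineK// fin_num_measure.
(* Only countably many statements, indexed by [K] and [p], are collected, so that a single null set
   serves all real [c]. *)
have H K p : {ae P, forall s, exists N, forall n, (N <= n)%N ->
    birk theta (fun s => - g K s) n s <=
    (- (\sum_(k < K) fine (P (L k.+1))) + p.+1%:R^-1) * n%:R}.
  apply: (ergodic_limsup mtheta theta_inv theta_erg).
    have := integrableN (ig K); exact: eq_integrable.
  rewrite (_ : (fun s : S => (- g K s)%:E) = (fun s : S => - (g K s)%:E)%E)//.
  rewrite integralN; last exact: (integrable_add_def measurableT (ig K)).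
  by rewrite Eg fE -EFinN lte_fin ltrDl invr_gt0 ltr0n.
have := ae_foralln (fun K => ae_foralln (H K)).
apply: filterS => s hs c; rewrite uE => cu.
have [K cK] := series_gt_partial (fun i => measure_ge0 P _) cu.
rewrite fE lte_fin in cK; set e := (\sum_(k < K) _) in cK.
have ec : 0 < e - c by rewrite subr_gt0.
exists K; pose p := Num.Def.archi_bound (e - c)^-1.
have [N hN] := hs K p; exists N => n /hN.
rewrite countE -/(g K) /birk sumrN -/(birk theta (g K) n s) => h.
have hp : p.+1%:R^-1 <= e - c.
  rewrite -[leRHS]invrK lef_pV2 ?posrE ?invr_gt0 ?ltr0n//.
  apply: ltW; apply: (lt_trans (archi_boundP _)); last by rewrite ltr_nat.
  by rewrite invr_ge0 ltW.
have : (- e + p.+1%:R^-1) * n%:R <= - c * n%:R.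
  by rewrite ler_wpM2r// -lerBrDl opprK addrC.
by move: h; rewrite -/e mulNr => h /(le_trans h); rewrite lerN2.
Qed.

Hypothesis u_fin : (u < +oo)%E.

(** Here the truncation grows with [n], so the counts are compared with the Birkhoff sums of the
    full series [G], whose integral is [u]. *)
Lemma ergodic_count_upper : {ae P, forall s, forall c : R, (u < c%:E)%E ->
  exists N, forall n, (N <= n)%N -> (count n n s)%:R <= c * n%:R}.
Proof.
pose G (s : S) : \bar R := (\sum_(i <oo) (\1_(L i.+1) s)%:E)%E.
have mG : measurable_fun setT G.
  have := @ge0_emeasurable_sum _ _ R setT (fun i s => (\1_(L i.+1) s)%:E) xpredT.
  apply => //.
  by move=> k _; apply/measurable_EFinP; exact: measurable_indic.
have G0 s : (0 <= G s)%E by apply: nneseries_ge0 => i _ _; rewrite lee_fin.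
have IG : (\int[P]_s G s = u)%E.
  rewrite uE integral_nneseries//; last first.
    by move=> k; apply/measurable_EFinP; exact: measurable_indic.
  by apply: eq_eseriesr => k _; rewrite integral_indic// setIT.
have iG : P.-integrable setT G.
  apply/integrableP; split => //.
  under eq_integral => s _ do rewrite gee0_abs//.
  by rewrite IG.
pose F s := fine (G s).
have FG s : ((F s)%:E <= G s)%E.
  by rewrite /F; have := G0 s; case: (G s) => // _; exact: leey.
have F0 s : 0 <= F s by rewrite fine_ge0.
have mF : measurable_fun setT F by exact: measurableT_comp.
have iF : P.-integrable setT (EFin \o F).
  apply: (le_integrable measurableT _ _ iG); first exact/measurable_EFinP.
  by move=> s _; rewrite /= ger0_norm// gee0_abs.
have IF : (\int[P]_s (F s)%:E <= u)%E.
  rewrite -IG; apply: ge0_le_integral => //.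
  - by move=> s _; rewrite lee_fin.
  - exact/measurable_EFinP.
have ufin : u \is a fin_num.
  by rewrite ge0_fin_numE// -IG integral_ge0.
have H p : {ae P, forall s, exists N, forall n, (N <= n)%N ->
    birk theta F n s <= (fine u + p.+1%:R^-1) * n%:R}.
  apply: (ergodic_limsup mtheta theta_inv theta_erg) => //.
  apply: (le_lt_trans IF); rewrite -{1}(fineK ufin) lte_fin ltrDl invr_gt0 ltr0n//.
(* [fine] sends [+oo] to 0, so [F] dominates the counts only where [G] is finite along the whole
   orbit; the null set of [G] is pulled back by every iterate. *)
have Gfin : {ae P, forall s, forall i, G (iter i theta s) \is a fin_num}.
  apply: ae_foralln => i.
  have [N [mN N0 sN]] := integrable_ae measurableT iG.
  have mi := measurable_iter mtheta i.
  have mNi j : measurable (iter j theta @^-1` N).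
    by have := measurable_iter mtheta j measurableT mN; rewrite setTI.
  exists (iter i theta @^-1` N); split => //.
    elim: i {mi} => // i IH.
    rewrite (_ : iter i.+1 theta @^-1` N = theta @^-1` (iter i theta @^-1` N)).
      exact: etrans (theta_inv (mNi i)) IH.
    by apply/seteqP; split => s; rewrite /preimage /= -iterS -iterSr.
  by move=> s /= h; apply: sN => h'; exact/h/h'.
have := ae_foralln H; apply: filterS2 Gfin => s Gs hs c.
rewrite -(fineK ufin) lte_fin => uc.
have ec : 0 < c - fine u by rewrite subr_gt0.
pose p := Num.Def.archi_bound (c - fine u)^-1.
have [N hN] := hs p; exists N => n /hN h.
have hp : p.+1%:R^-1 <= c - fine u.
  rewrite -[leRHS]invrK lef_pV2 ?posrE ?invr_gt0 ?ltr0n//.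
  apply: ltW; apply: (lt_trans (archi_boundP _)); last by rewrite ltr_nat.
  by rewrite invr_ge0 ltW.
have {h} : birk theta F n s <= c * n%:R.
  by apply: (le_trans h); rewrite ler_wpM2r// -lerBrDl.
apply: le_trans; rewrite countE; apply: ler_sum => i _.
rewrite -lee_fin /F fineK// -sumEFin /G -(big_mkord xpredT (fun k => (\1_(L k.+1) (iter i theta s))%:E)).
by apply: nneseries_lim_ge => k _ _; rewrite lee_fin.
Qed.

Lemma ae_eventually_not : {ae P, forall s, exists J, forall j, (J <= j)%N -> s \notin L j}.
Proof.
have h := @lim_sup_set_cvg0 _ _ _ P (fun i => L i.+1) (fun i => mL i.+1).
exists (lim_sup_set (fun i => L i.+1)); split.
- apply: bigcapT_measurable => n; exact: bigcup_measurable.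
- by apply: h; rewrite -uE.
move=> s /= hs n _; apply: contrapT => hn; apply: hs.
exists n.+1 => -[//|j] nj; rewrite notin_setE => Lj; apply: hn.
by exists j.
Qed.

End event_counts.

(** * Pi-systems and measurability *)

Lemma preimage_gen_measurable d (T : measurableType d) (S : pointedType)
    (G : set_system S) (phi : T -> S) :
  (forall A, G A -> measurable (phi @^-1` A)) ->
  forall A, <<s G >> A -> measurable (phi @^-1` A).
Proof.
move=> mG; suff : <<s G >> `<=` [set A | measurable (phi @^-1` A)] by [].
apply: smallest_sub => //; split => [|B mB|F mF] /=.
- by rewrite preimage_set0.
- by rewrite setTD preimage_setC; exact: measurableC.
- by rewrite preimage_bigcup; exact: bigcupT_measurable.
Qed.

(** Dynkin's argument: for fixed [E] the identity is stable under complements and disjoint unions.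
    Allowing a second map on a second space makes the same lemma yield, with [E = setT], the
    equality of two laws. *)
Lemma pi_system_independence d1 d2 (T1 : measurableType d1) (T2 : measurableType d2)
    (R : realType) (Q1 : probability T1 R) (Q2 : probability T2 R) (S : pointedType)
    (G : set_system S) (phi : T1 -> S) (psi : T2 -> S) (E : set T1) :
  measurable E -> setI_closed G ->
  (forall A, G A -> measurable (phi @^-1` A)) ->
  (forall A, G A -> measurable (psi @^-1` A)) ->
  (forall A, G A -> Q1 (E `&` phi @^-1` A) = Q1 E * Q2 (psi @^-1` A))%E ->
  forall A, <<s G >> A -> (Q1 (E `&` phi @^-1` A) = Q1 E * Q2 (psi @^-1` A))%E.
Proof.
move=> mE GI mphi mpsi EG.
have mp := preimage_gen_measurable mphi.
have mq := preimage_gen_measurable mpsi.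
apply: (@dynkin_induction _ (g_sigma_algebraType G)) => //.
- by rewrite !preimage_setT setIT probability_setT mule1.
- move=> A mA EA; have qA : Q2 (psi @^-1` A) \is a fin_num.
    by apply: fin_num_measure; exact: mq.
  have E1 : phi @^-1` (~` A) = ~` (phi @^-1` A) by [].
  have E2 : psi @^-1` (~` A) = ~` (psi @^-1` A) by [].
  rewrite E1 E2 -setDE measureD//=; first last.
  + by rewrite ltey_eq fin_num_measure.
  + exact: mp.
  rewrite EA probability_setC; last exact: mq.
  by rewrite muleBr// ?mule1// fin_num_measure.
- move=> F mF tF EF; rewrite !preimage_bigcup setI_bigcupr.
  rewrite measure_bigcup//=; first last.
  + move=> i j _ _ [t [[_ hi] [_ hj]]]; apply: tF => //; by exists (phi t).
  + by move=> i _; apply: measurableI => //; exact: (mp _ (mF i)).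
  rewrite measure_bigcup//=; first last.
  + move=> i j _ _ [t [hi hj]]; apply: tF => //; by exists (psi t).
  + by move=> i _; exact: (mq _ (mF i)).
  have QE : Q1 E = (fine (Q1 E))%:E by rewrite fineK// fin_num_measure.
  rewrite QE -nneseriesZl//; apply: eq_eseriesr => i _; rewrite -QE; exact: EF.
Qed.

Lemma pi_system_law d1 d2 (T1 : measurableType d1) (T2 : measurableType d2)
    (R : realType) (Q1 : probability T1 R) (Q2 : probability T2 R) (S : pointedType)
    (G : set_system S) (phi : T1 -> S) (psi : T2 -> S) :
  setI_closed G ->
  (forall A, G A -> measurable (phi @^-1` A)) ->
  (forall A, G A -> measurable (psi @^-1` A)) ->
  (forall A, G A -> Q1 (phi @^-1` A) = Q2 (psi @^-1` A))%E ->
  forall A, <<s G >> A -> Q1 (phi @^-1` A) = Q2 (psi @^-1` A).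
Proof.
move=> GI mphi mpsi E A sA.
have := @pi_system_independence _ _ _ _ R Q1 Q2 S G phi psi setT measurableT GI mphi mpsi.
rewrite probability_setT => /(_ _ A sA); rewrite setTI mul1e; apply.
by move=> B GB; rewrite setTI mul1e E.
Qed.

Lemma measurable_exists d (T : measurableType d) (C : countType) (P : C -> set T) :
  (forall c, measurable (P c)) -> measurable [set t | exists c, P c t].
Proof.
move=> mP; rewrite (_ : [set t | _] =
    \bigcup_n (if unpickle n is Some c then P c else set0)).
  by apply: bigcupT_measurable => n; case: unpickle.
apply/seteqP; split => [t [c Pc]|t [n _]].
  by exists (pickle c) => //; rewrite pickleK.
by case: unpickle => // c Pc; exists c.
Qed.

Lemma measurable_forall d (T : measurableType d) (C : countType) (P : C -> set T) :
  (forall c, measurable (P c)) -> measurable [set t | forall c, P c t].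
Proof.
move=> mP; rewrite (_ : [set t | _] = ~` [set t | exists c, ~ P c t]).
  by apply: measurableC; apply: measurable_exists => c; exact: measurableC.
apply/seteqP; split => t /=; first by move=> h [c]; apply.
by move=> /forallNP h c; exact: contrapT.
Qed.

Lemma measurable_implyP d (T : measurableType d) (A B : set T) :
  measurable A -> measurable B -> measurable [set t | A t -> B t].
Proof.
move=> mA mB; rewrite (_ : [set t | _] = ~` A `|` B).
  by apply: measurableU => //; exact: measurableC.
apply/seteqP; split => t /=.
  by move=> h; have [/h|] := pselect (A t); [right|left].
by move=> [].
Qed.

Lemma measurable_pred d (T : measurableType d) (P : Prop) : measurable [set _ : T | P].
Proof.
have [h|h] := pselect P.
  by rewrite (_ : [set _ | P] = setT)//; apply/seteqP; split.
by rewrite (_ : [set _ | P] = set0)//; apply/seteqP; split.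
Qed.

Lemma measurable_countable_fibre d (T : measurableType d) (C : countType) (f : T -> C)
    (P : C -> Prop) :
  (forall c, measurable [set t | f t = c]) -> measurable [set t | P (f t)].
Proof.
move=> mf; rewrite (_ : [set t | _] = [set t | exists c, f t = c /\ P c]).
  apply: measurable_exists => c.
  exact: (measurableI _ _ (mf c) (measurable_pred T (P c))).
by apply/seteqP; split => [t Pt|t [c [<-]]]; [exists (f t)|].
Qed.

(** * Stacks and odometers *)

(** Only times before [n] count, so this is the number of departures from [x] made by time [n]. *)
Definition nvisits (X : nat -> int) (n : nat) (x : int) : nat :=
  (\sum_(m < n) (X m == x))%N.

Lemma nvisitsS X n x : nvisits X n.+1 x = (nvisits X n x + (X n == x))%N.
Proof. by rewrite /nvisits big_ord_recr. Qed.

Definition stack_walk (eta : int -> nat -> bool) (X : nat -> int) : Prop :=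
  X 0%N = 0 /\ forall n, X n.+1 =
    if eta (X n) (nvisits X n (X n)).+1 then X n + 1 else X n - 1.

Definition rights (a : nat -> bool) (m : nat) : nat := (\sum_(i < m) a i.+1)%N.

Lemma rightsS a m : rights a m.+1 = (rights a m + a m.+1)%N.
Proof. by rewrite /rights big_ord_recr. Qed.

Lemma leq_rights a m m' : (m <= m')%N -> (rights a m <= rights a m')%N.
Proof.
move=> /subnK <-; elim: (m' - m)%N => // k IH.
by rewrite addSn rightsS (leq_trans IH)// leq_addr.
Qed.

(** Upward minus downward crossings of the edge from [x] to [x + 1] depend only on the sides of this
    edge on which the start 0 and the position [X n] lie. The downward ones are the departures from
    [x + 1] minus those to the right; terms are moved across to avoid subtraction. *)
Lemma stack_walk_conservation eta X n x : stack_walk eta X ->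
  (rights (eta x) (nvisits X n x) + (x < 0)%R +
   rights (eta (x + 1)%R) (nvisits X n (x + 1)%R) =
   nvisits X n (x + 1)%R + (x < X n)%R)%N.
Proof.
move=> [X0 XS]; elim: n => [|n IH].
  by rewrite /nvisits /rights !big_ord0 X0; lia.
have E z : rights (eta z) (nvisits X n.+1 z) =
    (rights (eta z) (nvisits X n z) +
     ((X n == z) && eta (X n) (nvisits X n (X n)).+1))%N.
  rewrite nvisitsS; case: (eqVneq (X n) z) => [->|_]; last by rewrite !addn0.
  by rewrite addn1 rightsS.
rewrite !E XS !nvisitsS; move: IH.
case: (eta (X n) _) => /=; case: (eqVneq (X n) x); case: (eqVneq (X n) (x + 1)); lia.
Qed.

Lemma stack_walk_last_exit eta X n x : stack_walk eta X ->
  x < X n -> (0 < nvisits X n x)%N -> eta x (nvisits X n x).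
Proof.
move=> [X0 XS]; elim: n => [|n IH]; first by rewrite /nvisits big_ord0.
rewrite nvisitsS; case: (eqVneq (X n) x) => [<-|neq]; last first.
  rewrite addn0 => xX; apply: IH; move: xX; rewrite XS.
  by case: (eta _ _); lia.
by rewrite addn1 XS; case: (eta _ _) => // h; exfalso; lia.
Qed.

(* [N x] is the number of departures from [x] of a walk run until it first hits
   [j]; the equation says that [x] is left to the right once more than [x + 1]
   is left to the left. *)
Definition odometer (eta : nat -> nat -> bool) (j : nat) (N : nat -> nat) : Prop :=
  N j = 0%N /\ forall x, (x < j)%N ->
    (rights (eta x) (N x) + rights (eta x.+1) (N x.+1))%N = (N x.+1).+1 /\
    eta x (N x).

(** [rights a] is constant along runs of left arrows, so the number of right arrows alone does not
    fix [m]; it does once the last arrow used points right. *)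
Lemma rights_last_inj a m m' c : rights a m = c.+1 -> rights a m' = c.+1 ->
  a m -> a m' -> m = m'.
Proof.
wlog: m m' / (m <= m')%N.
  by move=> W; case/orP: (leq_total m m') => h *; [|apply/esym]; exact: W.
rewrite leq_eqVlt => /orP[/eqP//|]; case: m' => // m' mm' rm rm' _ am'.
have := @leq_rights a m m' mm'; rewrite rm.
by move: rm'; rewrite rightsS am'; lia.
Qed.

(** Downward induction from [j]: the value at [x + 1] gives the number of right arrows used at [x],
    and the last-arrow condition turns it into the number of departures. *)
Lemma odometer_uniq eta j N N' : odometer eta j N -> odometer eta j N' ->
  forall x, (x <= j)%N -> N x = N' x.
Proof.
move=> [N0 H] [N0' H'] x /subKn <-.
elim: (j - x)%N => [|i IH]; first by rewrite subn0 N0 N0'.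
have [ij|ij] := ltnP i j; last first.
  by move: IH; have -> : (j - i.+1 = j - i)%N by lia.
have xj : (j - i.+1 < j)%N by lia.
have [e a] := H _ xj; have [e' a'] := H' _ xj.
have E : (j - i.+1).+1 = (j - i)%N by lia.
move: e e'; rewrite E IH => e e'.
(* Right departures do not exceed departures, so the number of right arrows at the lower site is at
   least 1, as [rights_last_inj] requires. *)
have h : (rights (eta (j - i)%N) (N' (j - i)%N) <= N' (j - i)%N)%N.
  by rewrite /rights (leq_trans (leq_sum _ (fun i _ => leq_b1 _)))// sum1_card card_ord.
apply: (@rights_last_inj (eta (j - i.+1)%N) _ _
  (N' (j - i) - rights (eta (j - i)) (N' (j - i)))%N) => //; lia.
Qed.

(** For a walk with unit steps started at 0, asking for [X m < j] is the same as asking for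
    [X m <> j], and it bounds the past directly. *)
Definition first_hit (X : nat -> int) (j n : nat) : Prop :=
  X n = j /\ forall m, (m < n)%N -> X m < j.

Lemma stack_walk_step eta X n : stack_walk eta X ->
  X n - 1 <= X n.+1 <= X n + 1.
Proof. by case=> _ ->; case: (eta _ _); lia. Qed.

Lemma stack_walk_ge eta X n k : stack_walk eta X -> X n - k%:Z <= X (n + k)%N.
Proof.
move=> sw; elim: k => [|k IH]; first by rewrite addn0; lia.
by have := stack_walk_step (n + k) sw; rewrite addnS; lia.
Qed.

Lemma ex_first_hit eta X j n : stack_walk eta X -> X n = j%:Z ->
  exists n', first_hit X j n'.
Proof.
move=> sw Xn; pose P n := X n == j%:Z.
have exP : exists n, P n by exists n; exact/eqP.
exists (ex_minn exP); case: ex_minnP => m /eqP Xm min; split => //.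
elim => [|k IH] km.
  have X0 := proj1 sw; rewrite X0; suff : j <> 0%N by lia.
  move=> j0; have := min 0%N; rewrite /P X0 j0 eqxx => /(_ isT).
  by rewrite leqNgt km.
have h := IH (ltnW km); have := stack_walk_step k sw.
have : X k.+1 != j by apply: contraTneq km => /eqP/min; rewrite -leqNgt.
by lia.
Qed.

(** The start 0 is at or left of [i + x], and [X n = i + k] is right of it, so every edge of the
    window has net flow 1. Sites left of [i] do not occur in the equations; uniqueness thus makes
    these counts a function of the stacks in the window. *)
Lemma odometer_first_hit eta X i k n : stack_walk eta X -> first_hit X (i + k) n ->
  odometer (fun x => eta (Posz (i + x))) k (fun x => nvisits X n (Posz (i + x))).
Proof.
move=> sw [Xn Xlt]; split.
  rewrite /nvisits big1// => m _; apply/eqP; rewrite eqb0.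
  by have := Xlt m (ltn_ord m); lia.
move=> x xk.
have := stack_walk_conservation n (Posz (i + x)) sw; rewrite Xn.
have -> : Posz (i + x) + 1 = Posz (i + x.+1) by lia.
move=> E; split; first by lia.
apply: (stack_walk_last_exit sw); first by rewrite Xn; lia.
(* Without a departure from [i + x], conservation would make the right departures from the next site
   exceed all its departures. *)
rewrite lt0n; apply/eqP => h; move: E; rewrite h {1}/rights big_ord0.
set a := nvisits _ _ _.
have : (rights (eta (Posz (i + x.+1))) a <= a)%N.
  by rewrite /rights (leq_trans (leq_sum _ (fun i _ => leq_b1 _)))// sum1_card card_ord.
lia.
Qed.

(* The walk started from scratch on the sites [>= 0] needs fewer than [k] steps
   on these sites between its first hits of [k] and of [k + 1]. *)
Definition short_gap (eta : nat -> nat -> bool) (k : nat) : Prop :=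
  exists s s' : seq nat, [/\ odometer eta k (nth 0%N s),
    odometer eta k.+1 (nth 0%N s') &
    (\sum_(x < k.+1) nth 0 s' x < \sum_(x < k.+1) nth 0 s x + k)%N].

Lemma eq_odometer eta j N N' : (forall x, (x <= j)%N -> N x = N' x) ->
  odometer eta j N -> odometer eta j N'.
Proof.
move=> E [N0 H]; split; first by rewrite -E.
by move=> x xj; rewrite -!E ?(ltnW xj)//; exact: H.
Qed.

Lemma first_hit_leq X j n n' : first_hit X j n -> first_hit X j.+1 n' -> (n < n')%N.
Proof.
move=> [Xn Xlt] [Xn' _]; rewrite ltnNge; apply/negP; rewrite leq_eqVlt => /orP[/eqP E|/Xlt]; last by lia.
by move: Xn'; rewrite E Xn; lia.
Qed.

Lemma nvisits_window X n n' i k : (n <= n')%N ->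
  (\sum_(x < k.+1) nvisits X n' (Posz (i + x)) =
   \sum_(x < k.+1) nvisits X n (Posz (i + x)) +
   \sum_(n <= m < n') (Posz i <= X m <= Posz (i + k))%R)%N.
Proof.
move=> nn'.
have E m : ((Posz i <= X m <= Posz (i + k))%R : nat) =
    (\sum_(x < k.+1) (X m == Posz (i + x)))%N.
  case: (boolP (Posz i <= X m <= Posz (i + k))) => h.
    have hx : (`|X m - i| < k.+1)%N by lia.
    rewrite (bigD1 (Ordinal hx))//= big1 ?addn0.
      by apply/eqP; rewrite eq_sym eqb1; apply/eqP; lia.
    move=> y /eqP yx; apply/eqP; rewrite eqb0; apply/eqP => e; apply: yx.
    by apply: val_inj => /=; lia.
  rewrite big1// => y _; apply/eqP; rewrite eqb0; apply: contra h => /eqP ->.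
  have := ltn_ord y; lia.
under [X in _ = (_ + X)%N]eq_bigr do rewrite E.
rewrite [X in (_ + X)%N]exchange_big /= -big_split /=; apply: eq_bigr => x _.
by rewrite /nvisits -!(big_mkord xpredT (fun m => (X m == Posz (i + x) : nat))) (big_cat_nat (n := n)).
Qed.

(** The two odometers differ in total by the time spent in [[i, i + k]] between the hits of [i + k]
    and [i + k + 1]. This time is at most the gap, and if the gap were [k] or more, its first [k]
    instants would already lie in the window. Uniqueness identifies any witnesses [s], [s'] with the
    actual counts. *)
Lemma short_gapP eta X i k n n' : stack_walk eta X ->
  first_hit X (i + k) n -> first_hit X (i + k).+1 n' ->
  (n' < n + k)%N <-> short_gap (fun x => eta (Posz (i + x))) k.
Proof.
move=> sw hn hn'.
have nn' := ltnW (first_hit_leq hn hn').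
have on := odometer_first_hit sw hn.
have on' := odometer_first_hit (i := i) (k := k.+1) sw.
rewrite addnS in on'; have {}on' := on' _ hn'.
have W := nvisits_window X i k nn'.
split=> [lt|[s [s' [os os' lt]]]].
  exists (mkseq (fun x => nvisits X n (Posz (i + x))) k.+1).
  exists (mkseq (fun x => nvisits X n' (Posz (i + x))) k.+2).
  split.
  - by apply: eq_odometer on => x xk; rewrite nth_mkseq.
  - by apply: eq_odometer on' => x xk; rewrite nth_mkseq.
  - under eq_bigr => x _ do rewrite nth_mkseq ?(leq_trans (ltn_ord x))//.
    under [X in (_ < X + _)%N]eq_bigr => x _ do rewrite nth_mkseq ?ltn_ord//.
    rewrite W ltn_add2l.
    apply: (@leq_ltn_trans (n' - n)); last by lia.
    rewrite (leq_trans (leq_sum _ (fun i _ => leq_b1 _)))// sum_nat_const_nat muln1//.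
rewrite ltnNge; apply/negP => le.
move: lt; rewrite (eq_bigr (fun x : 'I_k.+1 => nvisits X n' (Posz (i + x)))); last first.
  by move=> x _; apply: (odometer_uniq os' on'); rewrite ltnW.
rewrite [X in (_ < X + _)%N](eq_bigr (fun x : 'I_k.+1 => nvisits X n (Posz (i + x)))); last first.
  by move=> x _; apply: (odometer_uniq os on); rewrite -ltnS.
rewrite W ltn_add2l ltnNge => /negP; apply.
(* At each of the times [n] to [n + k - 1] the walk has lost less than [k] from [i + k] and has not
   reached [i + k + 1], so it is in the window. *)
rewrite (big_cat_nat (n := (n + k)%N)) ?leq_addr//=.
apply: leq_trans (leq_addr _ _).
rewrite -{1}(addKn n k) -[X in (X <= _)%N]muln1 -sum_nat_const_nat.
rewrite big_nat [X in (_ <= X)%N]big_nat; apply: leq_sum.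
move=> m /andP[nm mk]; rewrite lt0b.
have := stack_walk_ge n (m - n) sw; rewrite subnKC// (proj1 hn).
have := hn'.2 m (leq_trans mk le); lia.
Qed.

(** * From hitting times to speed *)

Lemma first_hit_min X j n m : first_hit X j n -> X m = j%:Z -> (n <= m)%N.
Proof. by move=> [_ h] Xm; rewrite leqNgt; apply/negP => /h; rewrite Xm ltxx. Qed.

Lemma gap_eventP X k n n' : first_hit X k n -> first_hit X k.+1 n' ->
  gap_event X k <-> (n + k <= n')%N.
Proof.
move=> hn hn'; split=> [|le m Xm].
  move=> /(_ _ hn'.1)[m [Xm le]]; apply: leq_trans le.
  by rewrite leq_add2r (first_hit_min hn).
by exists n; split; [exact: hn.1|rewrite (leq_trans le)// (first_hit_min hn')].
Qed.

Section hitting_times.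
Variables (eta : int -> nat -> bool) (X : nat -> int) (tau : nat -> nat).
Hypotheses (sw : stack_walk eta X) (tauP : forall j, first_hit X j (tau j)).

Let long (i k : nat) : bool := ~~ `[< short_gap (fun x => eta (Posz (i + x))) k >].

Lemma longE i k : long i k = (tau (i + k) + k <= tau (i + k).+1)%N.
Proof.
rewrite /long leqNgt; congr (~~ _); apply/asboolP/idP.
  by move/(short_gapP sw (tauP (i + k)) (tauP (i + k).+1)).
by move=> h; apply/(short_gapP sw (tauP (i + k)) (tauP (i + k).+1)).
Qed.

Lemma gap_event_long k : gap_event X k <-> long 0 k.
Proof. by rewrite longE add0n; exact: gap_eventP. Qed.

Lemma tau_lt j : (tau j < tau j.+1)%N.
Proof. exact: first_hit_leq. Qed.

Lemma tau0 : tau 0 = 0%N.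
Proof.
by apply/eqP; rewrite -leqn0 (first_hit_min (tauP 0))// (proj1 sw).
Qed.

Lemma tau_mono j j' : (j <= j')%N -> (tau j <= tau j')%N.
Proof.
by move=> /subnK <-; elim: (j' - j)%N => // k IH; rewrite addSn (leq_trans IH)// ltnW// tau_lt.
Qed.

Let D j := (tau j.+1 - tau j)%N.

Lemma sumD m n : (m <= n)%N -> (\sum_(m <= j < n) D j + tau m = tau n)%N.
Proof.
move=> /subnK <-; elim: (n - m)%N => [|k IH]; first by rewrite add0n big_geq.
by rewrite addSn big_nat_recr ?leq_addl//= addnAC IH /D subnKC// ltnW// tau_lt.
Qed.

Lemma longD i k : long i k = (k <= D (i + k))%N.
Proof. by rewrite longE /D -leq_subRL// ltnW// tau_lt. Qed.

Lemma sum_leD j K : (\sum_(1 <= k < K.+1) (k <= D j) <= D j)%N.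
Proof.
elim: K => [|K IH]; first by rewrite big_geq.
have [h|h] := leqP K.+1 (D j).
  apply: leq_trans h.
  by rewrite (leq_trans (leq_sum _ (fun i _ => leq_b1 _)))// sum_nat_const_nat muln1 subn1.
by rewrite big_nat_recr//= (leqNgt K.+1) h addn0.
Qed.

(** Group the pairs by [j = i + k], which is below [n + K]: those with a given [j] are among the
    [k <= D j], hence number at most [D j]. *)
Lemma tau_ge_sum_long n K :
  (\sum_(i < n) \sum_(1 <= k < K.+1) long i k <= tau (n + K))%N.
Proof.
rewrite -(sumD (leq0n _)) tau0 addn0.
apply: (@leq_trans (\sum_(0 <= j < n + K) \sum_(1 <= k < K.+1) (k <= D j))).
  rewrite exchange_big /= [leqRHS]exchange_big /=.
  rewrite big_nat [leqRHS]big_nat; apply: leq_sum => k /andP[k1 kK].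
  rewrite -(big_mkord xpredT (fun i => (long i k : nat))).
  rewrite (big_cat_nat (n := k) (p := n + K))//=; last by lia.
  apply: leq_trans (leq_addl _ _).
  rewrite -{2}(add0n k) big_addn.
  have -> : (n + K - k = n + (K - k))%N by lia.
  rewrite (big_cat_nat (n := n) (p := n + (K - k)))//=; last by lia.
  apply: leq_trans (leq_addr _ _).
  by apply: leq_sum => i _; rewrite longD.
by apply: leq_sum => j _; exact: sum_leD.
Qed.

(** From [J] on, [D j < j], so each [k] from 1 to [D j] corresponds to a genuine shift
    [i = j - k >= 0] and [D j] is counted in full. The gaps before [J] make up [tau J]. *)
Lemma tau_le_sum_long n J : (J <= n)%N -> (forall j, (J <= j)%N -> ~~ long 0 j) ->
  (tau n <= tau J + \sum_(i < n) \sum_(1 <= k < n.+1) long i k)%N.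
Proof.
move=> Jn H; rewrite -(sumD Jn) addnC leq_add2l.
apply: (@leq_trans (\sum_(J <= j < n) \sum_(1 <= k < n.+1) ((k <= j) && long (j - k) k))).
  rewrite big_nat [leqRHS]big_nat; apply: leq_sum => j /andP[Jj jn].
  have := H j Jj; rewrite longD add0n -ltnNge => Dj.
  apply: (@leq_trans (\sum_(1 <= k < (D j).+1) ((k <= j) && long (j - k) k))).
    rewrite -[leqLHS]muln1 -[X in (X * _ <= _)%N]subn0 -subSS -sum_nat_const_nat.
    rewrite big_nat [leqRHS]big_nat; apply: leq_sum => k /andP[k1 kD].
    by rewrite longD subnK; lia.
  have Dn : ((D j).+1 <= n.+1)%N by rewrite ltnS ltnW// (ltn_trans Dj).
  by rewrite [leqRHS](big_cat_nat (n := (D j).+1))//= leq_addr.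
rewrite exchange_big /= [leqRHS]exchange_big /=.
rewrite big_nat [leqRHS]big_nat; apply: leq_sum => k /andP[k1 kn].
rewrite -(big_mkord xpredT (fun i => (long i k : nat))).
apply: (@leq_trans (\sum_(0 <= j < n) ((k <= j) && long (j - k) k))).
  by rewrite [leqRHS](big_cat_nat (n := J))//= leq_addl.
rewrite (big_cat_nat (n := k))//=.
rewrite big_nat big1 ?add0n; last by move=> j /andP[_ jk]; rewrite leqNgt jk.
rewrite -{1}(add0n k) big_addn.
rewrite [leqRHS](big_cat_nat (n := (n - k)%N))//= ?leq_subr//.
apply: leq_trans (leq_addr _ _).
by apply: leq_sum => j _; rewrite leq_addl addnK.
Qed.

Variable R : realType.

(** If [X n = m] with [m] above [N], then [c * m <= tau m <= n]. *)
Lemma walk_upper (c : R) : 0 < c ->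
  (exists N, forall n, (N <= n)%N -> c * n%:R <= (tau n)%:R) ->
  exists N : nat, forall n, c * (X n)%:~R <= Num.max (c * N%:R) n%:R.
Proof.
move=> c0 [N hN]; exists N => n; rewrite le_max.
have [h|h] := leP (X n) N.
  by rewrite ler_pM2l// [N%:R]pmulrn ler_int h.
apply/orP; right.
have Xn : X n = (`|X n|%N)%:Z by lia.
rewrite Xn -pmulrn; apply: (le_trans (hN `|X n|%N _)); first by lia.
by rewrite ler_nat (first_hit_min (tauP _)).
Qed.

(** For [n] between [tau k] and [tau k.+1] the walk is at least [k - (n - tau k)], and the bounds on
    hitting times make [n - tau k] at most [(c - c') * k + c]. The condition [c < c' + 1] keeps the
    resulting coefficient of [k] positive. *)
Lemma walk_lower (c c' : R) : 0 < c -> c' <= c -> c < c' + 1 ->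
  (exists N, forall n, (N <= n)%N -> c' * n%:R <= (tau n)%:R <= c * n%:R) ->
  exists N : nat, forall n, (N <= n)%N ->
    (1 - (c - c')) * (n%:R / c - 1) - c <= (X n)%:~R.
Proof.
move=> c0 cc' cc1 [N hN]; exists (tau N) => n Nn.
have [k [kn nk]] : exists k, (tau k <= n)%N /\ (n < tau k.+1)%N.
  have ub k : (tau k <= n)%N -> (k <= n)%N.
    apply: leq_trans; elim: k => // k IH; exact: leq_ltn_trans IH (tau_lt k).
  have ex : exists k, (tau k <= n)%N by exists 0%N; rewrite tau0.
  exists (ex_maxn ex ub); case: ex_maxnP => k kn km; split => //.
  by rewrite ltnNge; apply/negP => /km; rewrite ltnn.
have Nk : (N <= k)%N.
  rewrite leqNgt; apply/negP => kN; have := tau_mono kN.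
  by move/(leq_trans nk); rewrite ltnNge Nn.
have XkR : (k%:R - (n%:R - (tau k)%:R) : R) <= (X n)%:~R.
  have := stack_walk_ge (tau k) (n - tau k) sw; rewrite subnKC// (proj1 (tauP k)).
  rewrite -(ler_int R) => h; apply: le_trans h.
  by rewrite rmorphB /= -natrB// -!pmulrn.
have /andP[h1 _] := hN k Nk; have /andP[_ h2] := hN k.+1 (leq_trans Nk (leqnSn _)).
have nk' : n%:R <= (tau k.+1)%:R :> R by rewrite ler_nat ltnW.
apply: le_trans XkR; rewrite -natr1 in h2.
have kc : n%:R / c - 1 <= k%:R :> R.
  by rewrite lerBlDr ler_pdivrMr// mulrC (le_trans nk').
apply: (@le_trans _ _ ((1 - (c - c')) * k%:R - c)).
  by rewrite lerD2r ler_wpM2l//; lra.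
by nra.
Qed.

End hitting_times.

Lemma cvg_walk_speed (R : realType) (x : nat -> R) (v : R) :
  (forall e, 0 < e -> exists N, forall n, (N <= n)%N -> x n <= (v + e) * n%:R) ->
  (forall e, 0 < e -> exists N, forall n, (N <= n)%N -> (v - e) * n%:R <= x n) ->
  x n / n%:R @[n --> \oo] --> v.
Proof.
move=> U L; apply/cvgrPdist_le => e e0.
have [N1 h1] := U e e0; have [N2 h2] := L e e0.
exists (maxn N1 N2).+1 => // n /= Nn.
have n0 : 0 < n%:R :> R by rewrite ltr0n; lia.
rewrite ler_distlC ler_pdivlMr// ler_pdivrMr// h1 ?h2//; lia.
Qed.

Lemma eventually_le_mul (R : realType) (e C : R) : 0 < e ->
  exists N, forall n, (N <= n)%N -> C <= e * n%:R.
Proof.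
move=> e0; exists (Num.Def.archi_bound (`|C| / e)) => n Nn.
rewrite -ler_pdivrMl// mulrC.
apply: (@le_trans _ _ (`|C| / e)); first by rewrite ler_pM2r ?invr_gt0// ler_norm.
apply/ltW/(lt_le_trans (archi_boundP _)); last by rewrite ler_nat.
by rewrite divr_ge0// ltW.
Qed.

Lemma stack_walk_speed (R : realType) eta X tau (u : \bar R) :
  stack_walk eta X -> (forall j, first_hit X j (tau j)) -> (1 <= u)%E ->
  (forall c, (c%:E < u)%E -> exists N, forall n, (N <= n)%N -> c * n%:R <= (tau n)%:R :> R) ->
  (forall c, (u < c%:E)%E -> exists N, forall n, (N <= n)%N -> (tau n)%:R <= c * n%:R :> R) ->
  (forall e, 0 < e -> exists N, forall n, (N <= n)%N -> - e * n%:R <= (X n)%:~R :> R) ->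
  ((X n)%:~R / n%:R : R) @[n --> \oo] --> (if u is +oo%E then 0 else (fine u)^-1).
Proof.
move=> sw tauP u1 Hlow Hup Hlim; apply: cvg_walk_speed => e e0.
  set v : R := if u is +oo%E then 0 else _.
  (* The rate is [c = 1 / (v + e / 2)], which is below [u] also when [u] is infinite and [v = 0]. *)
  have [c [c0 cu cv]] : exists c : R, [/\ 0 < c, (c%:E < u)%E & c^-1 <= v + e / 2].
    rewrite /v; case: u u1 {Hlow Hup v} => [r| |] u1.
    - exists ((r^-1 + e / 2)^-1); have r1 : 1 <= r by rewrite -lee_fin.
      have r0 : 0 < r by lra.
      have ri : 0 < r^-1 by rewrite invr_gt0.
      rewrite invr_gt0 invrK lte_fin; split => //; first by lra.
      by rewrite -[ltRHS]invrK ltf_pV2 ?posrE//; lra.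
    - exists (e / 2)^-1; rewrite invrK add0r invr_gt0; split; [lra|exact: ltry|by []].
    - by rewrite leeNy_eq in u1.
  have [N hN] := walk_upper tauP c0 (Hlow c cu).
  have v0 : 0 <= v + e / 2 by rewrite (le_trans _ cv)// invr_ge0 ltW.
  have [M hM] := eventually_le_mul N%:R (divr_gt0 e0 (@ltr0n _ 2)).
  exists M => n Mn; have n0 : 0 <= n%:R :> R by [].
  have := hN n; rewrite le_max => /orP[|].
    rewrite ler_pM2l// => /le_trans; apply; apply: le_trans (hM n Mn) _.
    by rewrite ler_wpM2r//; lra.
  rewrite mulrC -ler_pdivlMr// => /le_trans; apply.
  by rewrite mulrC ler_wpM2r//; lra.
case: u u1 Hlow Hup => [r| |] u1 Hlow Hup; last by rewrite leeNy_eq in u1.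
- have r1 : 1 <= r by rewrite -lee_fin.
  (* [h <= 1 / 4] keeps [2 * h < 1]; [h <= e / 6] makes the loss [3 * h] in [key] at most [e / 2],
     and the other half of [e] absorbs the constant [1 + (r + h)]. *)
  pose h := Num.min (e / 6) (1 / 4).
  have [h0 he h4] : [/\ 0 < h, h <= e / 6 & h <= 1 / 4].
    rewrite /h lt_min !ge_min !lexx orbT; split => //; lra.
  have c0 : 0 < r + h by lra.
  have [|||N hN] := @walk_lower _ _ _ sw tauP R (r + h) (r - h) c0; [lra|lra| |].
    have [N1 h1] : exists N, forall n, (N <= n)%N -> (r - h) * n%:R <= (tau n)%:R.
      by apply: Hlow; rewrite lte_fin; lra.
    have [N2 h2] : exists N, forall n, (N <= n)%N -> (tau n)%:R <= (r + h) * n%:R.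
      by apply: Hup; rewrite lte_fin; lra.
    by exists (maxn N1 N2) => n; rewrite geq_max => /andP[? ?]; rewrite h1// h2.
  have [M hM] := eventually_le_mul (1 + (r + h)) (divr_gt0 e0 (@ltr0n _ 2)).
  exists (maxn N M) => n; rewrite geq_max => /andP[Nn Mn].
  apply: le_trans (hN n Nn); have := hM n Mn.
  set m : R := n%:R; have m0 : 0 <= m by [].
  (* Multiplied out, this uses [r >= 1] twice: [h / r <= h] and [h * r >= h]. *)
  have key : (r^-1 - 3 * h) <= (1 - 2 * h) / (r + h).
    rewrite ler_pdivlMr//.
    have rr : r * r^-1 = 1 by rewrite divff//; lra.
    have ri1 : r^-1 <= 1 by rewrite invf_le1//; lra.
    rewrite mulrBl mulrDr mulrC rr.
    have : h * r^-1 <= h by rewrite ler_piMr// ltW.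
    have : h * r >= h by rewrite ler_peMr// ltW.
    have : 0 <= h * h by nra.
    by nra.
  have : (r^-1 - 3 * h) * m <= (1 - 2 * h) / (r + h) * m by rewrite ler_wpM2r.
  have hm : h * m <= e / 6 * m by rewrite ler_wpM2r.
  rewrite (_ : (1 - (r + h - (r - h))) * (m / (r + h) - 1) - (r + h) =
    (1 - 2 * h) / (r + h) * m - (1 - 2 * h) - (r + h)); last by field; lra.
  rewrite /=; lra.
(* For [u = +oo] the limit is 0, and only the comparison with simple random walk bounds [X n] from
   below. *)
- have [N hN] := Hlim e e0; exists N => n /hN; by rewrite sub0r.
Qed.

(** * Simple random walk *)

(* The limit is affine on [x <= K], vanishes at [K] and is bounded. *)
Lemma ruin_cvg0 (R : realType) (K : int) (a : nat -> int -> R) :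
  (forall n x, 0 <= a n x <= 1) -> (forall n x, a n.+1 x <= a n x) ->
  (forall n x, x < K -> a n.+1 x = (a n (x + 1) + a n (x - 1)) / 2) ->
  (forall n x, K <= x -> a n x = 0) ->
  forall x, a n x @[n --> \oo] --> (0 : R).
Proof.
move=> a01 dec harm bd.
have cv x : cvgn (a ^~ x).
  apply: nonincreasing_is_cvgn.
    by apply/nonincreasing_seqP => n; exact: dec.
  by exists 0 => _ [n _ <-]; case/andP: (a01 n x).
pose l x := limn (a ^~ x).
have lP x : a n x @[n --> \oo] --> l x by exact: cv.
have l1 x : l x <= 1.
  apply: limr_le => //; apply: nearW => n; by case/andP: (a01 n x).
have l0 x : 0 <= l x.
  apply: limr_ge => //; apply: nearW => n; by case/andP: (a01 n x).
have lK x : K <= x -> l x = 0.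
  move=> Kx; apply/cvg_lim => //.
  rewrite (_ : a ^~ x = fun=> 0); first exact: cvg_cst.
  by apply/funext => n; exact: bd.
have lharm x : x < K -> l x = (l (x + 1) + l (x - 1)) / 2.
  move=> xK; have h1 : a n.+1 x @[n --> \oo] --> l x by rewrite (cvg_shiftS (a ^~ x)).
  have h2 : a n.+1 x @[n --> \oo] --> (l (x + 1) + l (x - 1)) / 2.
    rewrite (_ : (fun n => a n.+1 x) = (fun n => (a n (x + 1) + a n (x - 1)) / 2)).
      by apply: cvgMl; apply: cvgD; exact: lP.
    by apply/funext => n; exact: harm.
  exact: (cvg_unique _ h1 h2).
have lin i : l (K - i%:Z) = i%:R * l (K - 1).
  suff : l (K - i%:Z) = i%:R * l (K - 1) /\ l (K - i.+1%:Z) = i.+1%:R * l (K - 1) by case.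
  elim: i => [|i [IH1 IH2]].
    by split; [rewrite subr0 mul0r lK|rewrite mul1r].
  have ltK : K - i.+1%:Z < K by lia.
  split => //; have := lharm _ ltK.
  have -> : K - i.+1%:Z + 1 = K - i%:Z by lia.
  have -> : K - i.+1%:Z - 1 = K - i.+2%:Z by lia.
  rewrite IH1 IH2 -(natr1 i.+1) -(natr1 i); lra.
have lK1 : l (K - 1) = 0.
  apply/eqP; rewrite eq_le l0 andbT leNgt; apply/negP => lpos.
  have li : 0 <= (l (K - 1))^-1 by rewrite invr_ge0.
  have := archi_boundP li; set i := Num.Def.archi_bound _ => h.
  have := l1 (K - i%:Z); rewrite lin leNgt => /negP; apply.
  by rewrite -ltr_pdivrMr// mul1r.
move=> x; have [Kx|xK] := leP K x; first by rewrite -(lK x Kx); exact: lP.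
have -> : (0 : R) = l x.
  have -> : x = K - (`|K - x|%N)%:Z by lia.
  by rewrite lin lK1 mulr0.
exact: lP.
Qed.

Definition srw (R : realType) (s : nat -> R) (n : nat) : int :=
  \sum_(m < n) (if s m < 2^-1 then 1 else -1).

Lemma srwS (R : realType) (s : nat -> R) n :
  srw s n.+1 = (if s 0%N < 2^-1 then 1 else -1) + srw (fun m => s m.+1) n.
Proof. by rewrite /srw big_ord_recl. Qed.

Lemma srw_recr (R : realType) (s : nat -> R) n :
  srw s n.+1 = srw s n + (if s n < 2^-1 then 1 else -1).
Proof. by rewrite /srw big_ord_recr. Qed.

Lemma srwE (R : realType) (s : nat -> R) n :
  srw s n = n%:Z - ((\sum_(m < n) (2^-1 <= s m)%R)%N.*2)%:Z.
Proof.
elim: n => [|n IH]; first by rewrite /srw !big_ord0.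
by rewrite srw_recr IH big_ord_recr /= leNgt; case: (_ < _) => /=; lia.
Qed.

(** * Cookie walk *)

Definition unif (R : realType) (B : set R) : \bar R :=
  lebesgue_measure (B `&` `[0%R, 1%R]).

Lemma unif_setT (R : realType) : unif [set: R] = 1%E.
Proof.
by rewrite /unif setTI lebesgue_measure_itv /= lte_fin ltr01 -EFinB subr0.
Qed.

Lemma cyl_measurable_coord (R : realType) (I : Type) x i (B : set R) :
  measurable B -> cyl_measurable [set s : I -> nat -> R | B (s x i)].
Proof. by move=> mB; apply: sub_gen_smallest; exists x, i, B. Qed.

Lemma sigma_setI (S : pointedType) (G : set_system S) A B :
  <<s G >> A -> <<s G >> B -> <<s G >> (A `&` B).
Proof. exact: (@measurableI _ (g_sigma_algebraType G)). Qed.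

Lemma sigma_setT (S : pointedType) (G : set_system S) : <<s G >> [set: S].
Proof. exact: (@measurableT _ (g_sigma_algebraType G)). Qed.

(** * Boxes of coordinates on the rows of a stack *)

Definition row_space (R : realType) : measurableType _ :=
  g_sigma_algebraType (@cyl_gen R nat).

(** The generators in [cyl_gen] constrain one coordinate and are not closed under intersection;
    boxes on an [n] by [n] block are, and they generate the same events. *)
Definition square (R : realType) n (B : nat -> nat -> set R) : set (nat -> nat -> R) :=
  [set s | forall p : 'I_n * 'I_n, B p.1 p.2 (s p.1 p.2)].

Definition square_gen (R : realType) : set_system (nat -> nat -> R) :=
  [set A | exists n B, (forall x i, measurable (B x i)) /\ A = @square R n B].

Lemma setI_closed_square (R : realType) : setI_closed (@square_gen R).
Proof.
move=> _ _ [n [B [mB ->]]] [m [C [mC ->]]].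
exists (maxn n m), (fun x i => (if (x < n)%N && (i < n)%N then B x i else setT) `&`
  (if (x < m)%N && (i < m)%N then C x i else setT)).
split; first by move=> x i; apply: measurableI; case: ifP.
apply/seteqP; split => s.
  by move=> [h1 h2] [x i] /=; split; case: ifP => // /andP[xn im];
    [exact: (h1 (Ordinal xn, Ordinal im))|exact: (h2 (Ordinal xn, Ordinal im))].
move=> h; split => -[x i] /=.
  have xm : (x < maxn n m)%N by rewrite leq_max ltn_ord.
  have im : (i < maxn n m)%N by rewrite leq_max ltn_ord.
  by have [] := h (Ordinal xm, Ordinal im); rewrite /= !ltn_ord.
have xm : (x < maxn n m)%N by rewrite leq_max ltn_ord orbT.
have im : (i < maxn n m)%N by rewrite leq_max ltn_ord orbT.
by have [] := h (Ordinal xm, Ordinal im); rewrite /= !ltn_ord.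
Qed.

Lemma cyl_square (R : realType) A : @cyl_measurable R nat A -> <<s @square_gen R >> A.
Proof.
apply: smallest_sub; first exact: smallest_sigma_algebra.
move=> _ [x [i [B [mB ->]]]]; apply: sub_gen_smallest.
exists (maxn x i).+1, (fun y j => if (y == x) && (j == i) then B else setT).
split; first by move=> y j; case: ifP.
apply/seteqP; split => s /=.
  by move=> Bs [y j] /=; case: ifP => // /andP[/eqP -> /eqP ->].
have xm : (x < (maxn x i).+1)%N by rewrite ltnS leq_maxl.
have im : (i < (maxn x i).+1)%N by rewrite ltnS leq_maxr.
by move=> /(_ (Ordinal xm, Ordinal im)) /=; rewrite !eqxx.
Qed.

Lemma measurable_square (R : realType) A : @square_gen R A ->
  measurable (A : set (row_space R)).
Proof.
move=> [n [B [mB ->]]]; apply: (measurable_forall (T := row_space R)) => p.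
exact: cyl_measurable_coord.
Qed.

Lemma iter_seq_shift (R : Type) m (s : nat -> nat -> R) x i :
  iter m (@seq_shift R) s x i = s (m + x)%N i.
Proof.
elim: m s x => // m IH s x.
by rewrite iterSr IH /seq_shift addSn.
Qed.

Lemma measurable_seq_shift (R : realType) :
  measurable_fun setT (@seq_shift R : row_space R -> row_space R).
Proof.
move=> _ A mA; rewrite setTI; move: A mA.
apply: (preimage_gen_measurable (T := row_space R)) => _ [x [i [B [mB ->]]]].
exact: (cyl_measurable_coord x.+1 i mB).
Qed.

Lemma measurable_iter_seq_shift (R : realType) m :
  measurable_fun setT (iter m (@seq_shift R) : row_space R -> row_space R).
Proof.
elim: m => [|m IH]; first exact: measurable_id.
exact: (measurableT_comp (@measurable_seq_shift R) IH).
Qed.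

(** The rule sees time, site and visit number, so that one construction covers both the cookie walk,
    driven by time, and the stack walk, whose rule ignores time. *)
Fixpoint step_path (step : nat -> int -> nat -> bool) (n : nat) : seq int :=
  if n is m.+1 then
    let p := step_path step m in
    let x := head 0 p in
    (if step m x (count (pred1 x) p) then x + 1 else x - 1) :: p
  else [:: 0].

Definition step_walk step n : int := head 0 (step_path step n).

Lemma cwalk_step_walk (R : realType) (w : env R) u :
  cwalk w u = step_walk (fun n z k => u n < w z k).
Proof.
apply/funext => n; rewrite /cwalk /step_walk; congr head.
by elim: n => //= n ->.
Qed.

Lemma count_step_path step n x :
  count (pred1 x) (step_path step n) = nvisits (step_walk step) n.+1 x.
Proof.
elim: n => [|n IH]; first by rewrite /nvisits big_ord1 /= addn0.
by rewrite nvisitsS -IH addnC.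
Qed.

Lemma step_walkS step n : step_walk step n.+1 =
  if step n (step_walk step n) (nvisits (step_walk step) n (step_walk step n)).+1
  then step_walk step n + 1 else step_walk step n - 1.
Proof.
rewrite {1}/step_walk /= -/(step_walk step n) count_step_path nvisitsS eqxx.
by rewrite addn1.
Qed.

Lemma step_walk_stack eta : stack_walk eta (step_walk (fun=> eta)).
Proof. by split=> // n; rewrite step_walkS. Qed.

(** For a fixed [p], following it up to time [n] becomes a condition on the [n] choices made along
    [p] itself, at indices known in advance. Prefix probabilities thereby reduce to independent
    variables. *)
Lemma step_walk_prefix step (p : nat -> int) n :
  (forall m, (m <= n)%N -> step_walk step m = p m) <->
  p 0%N = 0 /\ forall m, (m < n)%N ->
    p m.+1 = if step m (p m) (nvisits p m (p m)).+1 then p m + 1 else p m - 1.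
Proof.
have eqv q m x : (forall i, (i <= m)%N -> q i = p i) -> nvisits q m x = nvisits p m x.
  by move=> E; apply: eq_bigr => i _; rewrite E// ltnW.
split=> [E|[p0 pS] m].
  split=> [|m mn]; first by rewrite -(E 0%N).
  have := step_walkS step m; rewrite (E m.+1 mn) (E m (ltnW mn)).
  rewrite (eqv (step_walk step) m) // => i im.
  by apply: E; rewrite (leq_trans im) // ltnW.
have [k] := ubnP m; elim: k m => // k IH [|m] mk mn; first by rewrite p0.
have IHi i : (i <= m)%N -> step_walk step i = p i.
  by move=> im; apply: IH; [exact: leq_ltn_trans im mk|exact: leq_trans im (ltnW mn)].
by rewrite (pS m mn) step_walkS (IHi m (leqnn m)) (eqv (step_walk step) m).
Qed.

(** Each return to a site raises its visit number, so the stack variables read along a fixed path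
    are all distinct. *)
Lemma visit_inj (p : nat -> int) : injective (fun m => (p m, (nvisits p m (p m)).+1)).
Proof.
have lt m m' : (m < m')%N -> p m = p m' -> (nvisits p m (p m) < nvisits p m' (p m'))%N.
  move=> mm' pp; rewrite -pp; apply: (@leq_trans (nvisits p m.+1 (p m))).
    by rewrite nvisitsS eqxx addn1.
  rewrite /nvisits -!(big_mkord xpredT (fun i => (p i == p m : nat))).
  by rewrite [leqRHS](big_cat_nat (n := m.+1))//= leq_addr.
move=> m m' [pp vv]; have [mm'|mm'|//] := ltngtP m m'.
  by have := lt _ _ mm' pp; rewrite vv ltnn.
by have := lt _ _ mm' (esym pp); rewrite vv ltnn.
Qed.

(** An arbitrary environment event combined with a box on finitely many driving variables: the form
    in which independence is given, and one stable under intersection. *)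
Definition joint_gen (R : realType) : set_system (env R * (nat -> R)) :=
  [set A | exists (A0 : set (env R)) n (B : nat -> set R),
     [/\ @cyl_measurable R int A0, forall k, measurable (B k) &
      A = [set s | A0 s.1 /\ forall k : 'I_n, B k (s.2 (k : nat))]]].

Definition joint_space (R : realType) : measurableType _ :=
  g_sigma_algebraType (@joint_gen R).

Lemma setI_closed_joint (R : realType) : setI_closed (@joint_gen R).
Proof.
move=> _ _ [A [n [B [mA mB ->]]]] [A' [m [B' [mA' mB' ->]]]].
exists (A `&` A'), (maxn n m), (fun k => (if (k < n)%N then B k else setT) `&`
  (if (k < m)%N then B' k else setT)).
split; first exact: sigma_setI.
  by move=> k; apply: measurableI; case: ifP.
apply/seteqP; split => s.
  by move=> [[h1 h2] [h1' h2']]; split => // k; split; case: ifP => // kn;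
    [exact: (h2 (Ordinal kn))|exact: (h2' (Ordinal kn))].
move=> [[h1 h1'] h]; split; split => // k.
  have km : (k < maxn n m)%N by rewrite leq_max ltn_ord.
  by have [] := h (Ordinal km); rewrite /= ltn_ord.
have km : (k < maxn n m)%N by rewrite leq_max ltn_ord orbT.
by have [] := h (Ordinal km); rewrite /= ltn_ord.
Qed.

Lemma measurable_joint_env (R : realType) x i :
  measurable_fun setT (fun s : joint_space R => s.1 x i).
Proof.
move=> _ B mB; rewrite setTI; apply: sub_gen_smallest.
exists [set w | B (w x i)], 0%N, (fun=> setT); split => //.
  exact: cyl_measurable_coord.
apply/seteqP; split => s /=; first by move=> ?; split => // -[].
by case.
Qed.

Lemma measurable_joint_driving (R : realType) n :
  measurable_fun setT (fun s : joint_space R => s.2 n).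
Proof.
move=> _ B mB; rewrite setTI; apply: sub_gen_smallest.
exists setT, n.+1, (fun k => if k == n then B else setT); split.
- exact: sigma_setT.
- by move=> k; case: ifP.
apply/seteqP; split => s /=.
  by move=> Bs; split => // k; case: ifP => // /eqP ->.
by move=> [_ /(_ ord_max)]; rewrite eqxx.
Qed.

HB.instance Definition _ := isPointed.Build int 0.

(** Two prefix cylinders are nested or disjoint; adding the empty set therefore makes them closed
    under intersection. *)
Definition path_gen : set_system (nat -> int) :=
  [set A | A = set0 \/ exists n p, A = [set X | forall m, (m <= n)%N -> X m = p m]].

Definition path_space : measurableType _ := g_sigma_algebraType path_gen.

Lemma setI_closed_path : setI_closed path_gen.
Proof.
move=> A B [->|[n [p ->]]]; first by left; rewrite set0I.
move=> [->|[m [q ->]]]; first by left; rewrite setI0.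
wlog nm : n m p q / (n <= m)%N.
  move=> W; case/orP: (leq_total n m) => h; first exact: W.
  by rewrite setIC; exact: W.
have [pq|pq] := pselect (forall k, (k <= n)%N -> p k = q k); [right|left].
  exists m, q; apply/seteqP; split => X; first by move=> [].
  by move=> XE; split => // k kn; rewrite XE ?pq// (leq_trans kn).
apply/seteqP; split => X //= -[h1 h2]; apply: pq => k kn.
by rewrite -h1// h2// (leq_trans kn).
Qed.

Lemma measurable_path_at n z : measurable [set X : path_space | X n = z].
Proof.
rewrite (_ : [set X | _] = [set X : path_space | exists s : seq int,
    (forall m, (m <= n)%N -> X m = nth 0 s m) /\ nth 0 s n = z]).
  apply: measurable_exists => s.
  apply: (measurableI [set X : path_space | forall m, (m <= n)%N -> X m = nth 0 s m] _).
    by apply: sub_gen_smallest; right; exists n, (nth 0 s).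
  exact: measurable_pred.
apply/seteqP; split => X /=; last by move=> [s [E <-]]; rewrite E.
move=> Xn; exists (mkseq X n.+1); split; last by rewrite nth_mkseq.
by move=> m mn; rewrite nth_mkseq.
Qed.

Lemma measurable_path_pred n (P : int -> Prop) :
  measurable [set X : path_space | P (X n)].
Proof. by apply: measurable_countable_fibre => z; exact: measurable_path_at. Qed.

(** * Measurability of odometers and short gaps *)

Definition stack_bits (R : realType) (s : row_space R * row_space R) (x i : nat) : bool :=
  s.2 x i < s.1 x i.

Lemma measurable_row_at (R : realType) x i :
  measurable_fun setT (fun s : row_space R => s x i).
Proof. by move=> _ B mB; rewrite setTI; exact: cyl_measurable_coord. Qed.

Lemma measurable_stack_bits (R : realType) x i (P : bool -> Prop) :
  measurable [set s : row_space R * row_space R | P (stack_bits s x i)].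
Proof.
apply: measurable_countable_fibre => b.
have := measurable_fun_ltr
  (measurableT_comp (@measurable_row_at R x i) (@measurable_snd _ _ (row_space R) (row_space R)))
  (measurableT_comp (@measurable_row_at R x i) (@measurable_fst _ _ (row_space R) (row_space R))).
by move=> /(_ measurableT [set b]); rewrite setTI; apply.
Qed.

Lemma measurable_rights (R : realType) x m (P : nat -> Prop) :
  measurable [set s : row_space R * row_space R | P (rights (stack_bits s x) m)].
Proof.
apply: measurable_countable_fibre; elim: m => [|m IH] c.
  rewrite (_ : [set s | _] = [set s | 0%N = c]); first exact: measurable_pred.
  by apply/seteqP; split => s; rewrite /rights /= big_ord0.
rewrite (_ : [set s | _] = [set s : row_space R * row_space R | exists a : nat,
    rights (stack_bits s x) m = a /\ (a + stack_bits s x m.+1)%N = c]).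
  apply: measurable_exists => a; apply: (measurableI _ _ (IH a)).
  exact: (measurable_stack_bits x m.+1 (fun b : bool => (a + b)%N = c)).
apply/seteqP; split => s /=; rewrite rightsS; first by move=> h; eexists.
by move=> [a [->]].
Qed.

Lemma measurable_odometer (R : realType) j N :
  measurable [set s : row_space R * row_space R | odometer (stack_bits s) j N].
Proof.
apply: measurableI; first exact: measurable_pred.
apply: measurable_forall => x; apply: measurable_implyP; first exact: measurable_pred.
apply: (measurableI _ _ _ (measurable_stack_bits x (N x) (fun b => b))).
rewrite [X in measurable X](_ : _ = [set s : row_space R * row_space R | exists a : nat,
    rights (stack_bits s x) (N x) = a /\
    (a + rights (stack_bits s x.+1) (N x.+1))%N = (N x.+1).+1]).
  apply: measurable_exists => a; apply: measurableI.
    exact: (measurable_rights x (N x) (fun b => b = a)).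
  exact: (measurable_rights x.+1 (N x.+1) (fun b => (a + b)%N = (N x.+1).+1)).
apply/seteqP; split => s /=; first by move=> h; eexists.
by move=> [a [->]].
Qed.

(** [short_gap] quantifies over finite sequences instead of functions, which makes this a countable
    union. *)
Lemma measurable_short_gap (R : realType) k :
  measurable [set s : row_space R * row_space R | short_gap (stack_bits s) k].
Proof.
apply: measurable_exists => N; apply: measurable_exists => N'.
rewrite [X in measurable X](_ : _ =
    [set s : row_space R * row_space R | odometer (stack_bits s) k (nth 0%N N)] `&`
    ([set s : row_space R * row_space R | odometer (stack_bits s) k.+1 (nth 0%N N')] `&`
    [set _ | (\sum_(x < k.+1) nth 0 N' x < \sum_(x < k.+1) nth 0 N x + k)%N])).
  apply: measurableI; first exact: measurable_odometer.
  by apply: measurableI; [exact: measurable_odometer|exact: measurable_pred].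
by apply/seteqP; split => s; [case|case=> ? []].
Qed.

(** Both walks use the same [u n]: if it is below 1/2, it is below the cookie too, so the cookie
    walk steps right whenever the simple walk does. *)
Lemma srw_le_cwalk (R : realType) (w : env R) u n :
  (forall z i, (0 < i)%N -> 2^-1 <= w z i) -> srw u n <= cwalk w u n.
Proof.
move=> w2; rewrite cwalk_step_walk; elim: n => [|n IH].
  by rewrite /srw big_ord0.
rewrite srw_recr step_walkS.
set x := step_walk _ n in IH *; set k := nvisits _ _ _.
have := w2 x k.+1 isT; case: (ltP (u n) 2^-1) => [lt le|ge _].
  by rewrite (lt_le_trans lt le) lerD2r.
by case: (_ < _); lia.
Qed.

Lemma step_walk_hits step (j n : nat) : j%:Z <= step_walk step n ->
  exists m, step_walk step m = j%:Z.
Proof.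
elim: n => [|n IH] h; first by exists 0%N; move: h; rewrite /step_walk /=; lia.
have [/IH//|lt] := leP j%:Z (step_walk step n).
by exists n.+1; move: h lt; rewrite step_walkS; case: (step _ _ _); lia.
Qed.

Lemma measurable_srw (R : realType) n (P : int -> Prop) :
  measurable [set s : joint_space R | P (srw s.2 n)].
Proof.
apply: (measurable_countable_fibre (T := joint_space R)); elim: n => [|n IH] c.
  rewrite [X in measurable X](_ : _ = [set s | 0 = c]).
    exact: (measurable_pred (joint_space R)).
  by apply/seteqP; split => s; rewrite /srw /= big_ord0.
rewrite [X in measurable X](_ : _ = [set s : joint_space R | exists a : int,
    srw s.2 n = a /\ a + (if s.2 n < 2^-1 then 1 else -1) = c]).
  apply: (measurable_exists (T := joint_space R)) => a; apply: (measurableI _ _ (IH a)).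
  apply: (measurable_countable_fibre (T := joint_space R) (f := fun s => s.2 n < 2^-1)
    (fun b => a + (if b then 1 else -1) = c)) => b.
  have := measurable_fun_ltr (@measurable_joint_driving R n) (measurable_cst (2^-1 : R)).
  by move=> /(_ measurableT [set b]); rewrite setTI; apply.
apply/seteqP; split => s /=; rewrite srw_recr; first by move=> h; eexists.
by move=> [a [->]].
Qed.

Lemma measurable_lt_half (R : realType) : measurable [set r : R | r < 2^-1].
Proof.
by rewrite (_ : [set r : R | _] = `]-oo, 2^-1[%classic).
Qed.

Lemma unif_lt_half (R : realType) : unif [set r : R | r < 2^-1] = (2^-1)%:E.
Proof.
rewrite /unif (_ : _ `&` _ = `[0, 2^-1[%classic).
  by rewrite lebesgue_measure_itv /= lte_fin invr_gt0 ltr0n -EFinB subr0.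
apply/seteqP; split => r /=; rewrite !in_itv /=.
  by move=> [-> /andP[->]].
by move=> /andP[-> lt]; split => //=; lra.
Qed.

Lemma unif_ge_half (R : realType) : unif [set r : R | ~ (r < 2^-1)] = (2^-1)%:E.
Proof.
rewrite /unif (_ : _ `&` _ = `[2^-1, 1]%classic).
  rewrite lebesgue_measure_itv /= lte_fin invf_lt1 ?ltr1n// -EFinB.
  by congr (_%:E); lra.
apply/seteqP; split => r /=; rewrite !in_itv /=.
  by move=> [/negP]; rewrite -leNgt => -> /andP[_ ->].
by move=> /andP[ge ->]; split; [apply/negP; rewrite -leNgt|rewrite andbT; lra].
Qed.

Lemma cvg_inv_nat (R : realType) (x : nat -> R) (v : R) :
  x n @[n --> \oo] --> v <->
  forall p : nat, exists N, forall n, (N <= n)%N -> `|v - x n| <= p.+1%:R^-1.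
Proof.
split=> [/cvgrPdist_le h p|h].
  by have [|N _ hN] := h p.+1%:R^-1; [rewrite invr_gt0 ltr0n|exists N].
apply/cvgrPdist_le => e e0; have [N hN] := h (Num.Def.archi_bound e^-1).
exists N => // n /hN /le_trans; apply.
rewrite -[leRHS]invrK lef_pV2 ?posrE ?invr_gt0 ?ltr0n//.
apply: ltW; apply: (lt_trans (archi_boundP _)); last by rewrite ltr_nat.
by rewrite invr_ge0 ltW.
Qed.

(** * Independence of the driving variables and the zero-one law for arrows *)

Section driven.
Variables (R : realType) (d : measure_display) (T : measurableType d)
  (Q : probability T R) (W : T -> env R) (U : nat -> T -> R).
Hypotheses (HWmeas : forall z i, measurable_fun setT (fun t => W t z i))
  (HUmeas : forall n, measurable_fun setT (U n))
  (Hindep : forall (A : set (env R)) (n : nat) (B : nat -> set R),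
      @cyl_measurable R int A -> (forall k, measurable (B k)) ->
      Q (W @^-1` A `&` \bigcap_(k in [set k | (k < n)%N]) (U k @^-1` B k)) =
      (Q (W @^-1` A) * \prod_(k < n) lebesgue_measure (B k `&` `[0%R, 1%R]))%E).

Lemma measurable_U n B : measurable B -> measurable [set t | B (U n t)].
Proof. by move=> mB; have := HUmeas n measurableT mB; rewrite setTI. Qed.

Lemma measurable_W A : @cyl_measurable R int A -> measurable (W @^-1` A).
Proof.
apply: preimage_gen_measurable => _ [x [i [B [mB ->]]]].
by have := HWmeas x i measurableT mB; rewrite setTI.
Qed.

(** Complete the family to all indices below a bound by [setT], which contributes factors
    [unif setT = 1]. *)
Lemma indep_inj (I : finType) (sg : I -> nat) (A : set (env R)) (B : I -> set R) :
  injective sg -> @cyl_measurable R int A -> (forall k, measurable (B k)) ->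
  Q (W @^-1` A `&` [set t | forall k, B k (U (sg k) t)]) =
  (Q (W @^-1` A) * \prod_(k : I) unif (B k))%E.
Proof.
move=> sgI mA mB.
pose n := (\max_(k : I) sg k).+1.
have sgn k : (sg k < n)%N by rewrite ltnS /n leq_bigmax.
pose B' j := if [pick k | sg k == j] is Some k then B k else setT.
have B'E k : B' (sg k) = B k.
  rewrite /B'; case: pickP => [k' /eqP/sgI -> //|/(_ k)]; by rewrite eqxx.
have mB' j : measurable (B' j) by rewrite /B'; case: pickP.
have := Hindep n mA mB'.
rewrite (_ : \bigcap_(k in _) _ = [set t | forall k, B k (U (sg k) t)]); last first.
  apply/seteqP; split => t /= h.
    by move=> k; rewrite -B'E; apply: (h (sg k)); exact: sgn.
  move=> j /= jn; rewrite /preimage /= /B'; case: pickP => // k /eqP <-.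
  exact: h.
move=> ->; congr (_ * _)%E.
pose h (k : I) : 'I_n := Ordinal (sgn k).
rewrite -/(unif _) (bigID (fun j : 'I_n => j \in [set h k | k : I])) /=.
rewrite big_imset /=; last by move=> k k' _ _ [/sgI].
rewrite [X in (_ * X)%E]big1 ?mule1.
  by apply: eq_bigr => k _; rewrite B'E.
move=> j /imsetP jh; rewrite -[RHS](unif_setT R) /unif; congr (lebesgue_measure (_ `&` _)).
rewrite /B'; case: pickP => // k /eqP kj; exfalso; apply: jh.
by exists k => //; apply: val_inj.
Qed.

(* The driving variables are reused, through [pickle], as the uniform variables
   of the stacks: visit [i] of site [z] uses [U (pickle (z, i))]. *)
Definition arrows_row (t : T) : row_space R := fun x i => U (pickle (Posz x, i)) t.
Definition env_row (t : T) : row_space R := proj_nonneg (W t).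

Lemma measurable_env_row : measurable_fun setT env_row.
Proof.
move=> _ A mA; rewrite setTI; move: A mA.
apply: preimage_gen_measurable => _ [x [i [B [mB ->]]]].
by have := HWmeas x i measurableT mB; rewrite setTI.
Qed.

Lemma measurable_arrows_row : measurable_fun setT arrows_row.
Proof.
move=> _ A mA; rewrite setTI; move: A mA.
apply: preimage_gen_measurable => _ [x [i [B [mB ->]]]]; exact: measurable_U.
Qed.

Lemma cyl_proj_nonneg A : @cyl_measurable R nat A ->
  @cyl_measurable R int (@proj_nonneg R @^-1` A).
Proof.
move: A; apply: (preimage_gen_measurable
  (T := g_sigma_algebraType (@cyl_gen R int))) => _ [x [i [B [mB ->]]]].
exact: (cyl_measurable_coord (Posz x) i mB).
Qed.

Lemma square_law A m n B : @cyl_measurable R int A ->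
  (forall x i, measurable (B x i)) ->
  Q (W @^-1` A `&` [set t | square n B (iter m (@seq_shift R) (arrows_row t))]) =
  (Q (W @^-1` A) * \prod_(p : 'I_n * 'I_n) unif (B p.1 p.2))%E.
Proof.
move=> mA mB.
have sgI : injective (fun p : 'I_n * 'I_n => pickle (Posz (m + p.1), p.2 : nat)).
  move=> [x i] [y j] /(pcan_inj pickleK) [/addnI xy ij].
  by congr (_, _); exact: val_inj.
rewrite -(indep_inj sgI mA) //; congr (Q (_ `&` _)).
by apply/seteqP; split => t /= h p; have := h p; rewrite iter_seq_shift.
Qed.

Lemma rows_law n m B C : (forall x i, measurable (B x i)) ->
  (forall x i, measurable (C x i)) ->
  Q ([set t | square n B (arrows_row t)] `&`
     [set t | square m C (iter n (@seq_shift R) (arrows_row t))]) =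
  (\prod_(p : 'I_n * 'I_n) unif (B p.1 p.2) * \prod_(p : 'I_m * 'I_m) unif (C p.1 p.2))%E.
Proof.
move=> mB mC.
pose I := ('I_n * 'I_n + 'I_m * 'I_m)%type.
pose sg (p : I) := match p with
  | inl p => pickle (Posz p.1, p.2 : nat)
  | inr p => pickle (Posz (n + p.1), p.2 : nat) end.
pose D (p : I) := match p with inl p => B p.1 p.2 | inr p => C p.1 p.2 end.
have sgI : injective sg.
  move=> [[x i]|[x i]] [[y j]|[y j]] /(pcan_inj pickleK) [].
  - by move=> xy ij; congr (inl (_, _)); exact: val_inj.
  - by move=> xy; have := ltn_ord x; rewrite xy ltnNge leq_addr.
  - by move=> xy; have := ltn_ord y; rewrite -xy ltnNge leq_addr.
  - by move=> /addnI xy ij; congr (inr (_, _)); exact: val_inj.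
have mD p : measurable (D p) by case: p => p; [exact: mB|exact: mC].
have := indep_inj sgI (@sigma_setT (env R) (@cyl_gen R int)) mD.
rewrite preimage_setT setTI probability_setT mul1e big_sumType /= => <-.
congr (Q _); apply/seteqP; split => t /=.
  by move=> [h1 h2] [p|p]; [exact: h1|have := h2 p; rewrite iter_seq_shift].
move=> h; split => p; first exact: (h (inl p)).
by rewrite iter_seq_shift; exact: (h (inr p)).
Qed.

Lemma square_prob m n B : (forall x i, measurable (B x i)) ->
  Q [set t | square n B (iter m (@seq_shift R) (arrows_row t))] =
  (\prod_(p : 'I_n * 'I_n) unif (B p.1 p.2))%E.
Proof.
move=> mB; have := square_law m n (@sigma_setT (env R) (@cyl_gen R int)) mB.
by rewrite preimage_setT setTI probability_setT mul1e.
Qed.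

Lemma measurable_shift_arrows_row m (A : set (row_space R)) : measurable A ->
  measurable [set t | A (iter m (@seq_shift R) (arrows_row t))].
Proof.
move=> mA; have := measurableT_comp (@measurable_iter_seq_shift R m) measurable_arrows_row.
by move=> /(_ measurableT A mA); rewrite setTI.
Qed.

Lemma env_arrows_indep (A1 A2 : set (row_space R)) : measurable A1 -> measurable A2 ->
  Q (env_row @^-1` A1 `&` arrows_row @^-1` A2) =
  (Q (env_row @^-1` A1) * Q (arrows_row @^-1` A2))%E.
Proof.
move=> mA1 /cyl_square; move: A2.
apply: pi_system_independence => //.
- by have := measurable_env_row measurableT mA1; rewrite setTI.
- exact: setI_closed_square.
- by move=> A /measurable_square /(measurable_arrows_row measurableT); rewrite setTI.
- by move=> A /measurable_square /(measurable_arrows_row measurableT); rewrite setTI.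
move=> _ [n [B [mB ->]]].
have := square_law 0 n (cyl_proj_nonneg mA1) mB.
have := square_prob 0 n mB.
by rewrite /= => <-.
Qed.

Lemma arrows_shift_law m (A : set (row_space R)) : measurable A ->
  Q [set t | A (iter m (@seq_shift R) (arrows_row t))] = Q (arrows_row @^-1` A).
Proof.
move=> /cyl_square; move: A.
apply: (pi_system_law (phi := fun t => iter m (@seq_shift R) (arrows_row t))).
- exact: setI_closed_square.
- by move=> A /measurable_square; exact: measurable_shift_arrows_row.
- by move=> A /measurable_square; exact: (measurable_shift_arrows_row 0).
- by move=> _ [n [B [mB ->]]]; rewrite (square_prob m)// (square_prob 0).
Qed.

Lemma rows_tail_indep n B (A : set (row_space R)) : (forall x i, measurable (B x i)) ->
  measurable A ->
  Q ([set t | square n B (arrows_row t)] `&`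
     [set t | A (iter n (@seq_shift R) (arrows_row t))]) =
  (Q [set t | square n B (arrows_row t)] * Q (arrows_row @^-1` A))%E.
Proof.
move=> mB /cyl_square; move: A.
have mS : measurable (square n B : set (row_space R)).
  by apply: measurable_square; exists n, B.
apply: (pi_system_independence (phi := fun t => iter n (@seq_shift R) (arrows_row t))).
- exact: (measurable_shift_arrows_row 0).
- exact: setI_closed_square.
- by move=> A /measurable_square; exact: measurable_shift_arrows_row.
- by move=> A /measurable_square; exact: (measurable_shift_arrows_row 0).
move=> _ [m [C [mC ->]]].
by rewrite [LHS](rows_law n m mB mC) (square_prob 0 n mB) (square_prob 0 m mC).
Qed.

(** Kolmogorov's zero-one law: for each [n], [D] depends on the rows from [n] on and is independent
    of every box on the first [n] rows, hence of itself, so [r = r * r]. The sets [Dm m] may vary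
    with [m], as do the sections to which the lemma is applied. *)
Lemma arrows_zero_one (D : set (row_space R)) (Dm : nat -> set (row_space R)) :
  measurable D -> (forall m, measurable (Dm m)) ->
  (forall m, D = iter m (@seq_shift R) @^-1` Dm m) ->
  Q (arrows_row @^-1` D) = 0%E \/ Q (arrows_row @^-1` D) = 1%E.
Proof.
move=> mD mDm DE.
have QD m : Q (arrows_row @^-1` D) = Q (arrows_row @^-1` Dm m).
  by rewrite -(arrows_shift_law m (mDm m)) {1}(DE m).
have mD' : measurable (arrows_row @^-1` D) := measurable_shift_arrows_row 0 mD.
have ind A : <<s @square_gen R >> A -> Q (arrows_row @^-1` D `&` arrows_row @^-1` A) =
    (Q (arrows_row @^-1` D) * Q (arrows_row @^-1` A))%E.
  move: A; apply: pi_system_independence => //.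
  - exact: setI_closed_square.
  - by move=> A /measurable_square; exact: (measurable_shift_arrows_row 0).
  - by move=> A /measurable_square; exact: (measurable_shift_arrows_row 0).
  move=> _ [n [B [mB ->]]]; rewrite (QD n) muleC -(rows_tail_indep n mB (mDm n)).
  by rewrite setIC {1}(DE n).
have := ind D (cyl_square mD); rewrite setIid.
have [r ->] : exists r, Q (arrows_row @^-1` D) = r%:E.
  by exists (fine (Q (arrows_row @^-1` D))); rewrite fineK// fin_num_measure.
rewrite -EFinM => -[rr].
have : r * (r - 1) = 0 by rewrite mulrBr mulr1 -rr subrr.
by move/eqP; rewrite mulf_eq0 subr_eq0 => /orP[]/eqP ->; [left|right].
Qed.

(** * Stationarity and ergodicity of the stacks *)

Hypotheses
  (Hstat : forall A, @cyl_measurable R nat A ->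
      Q ((fun t => proj_nonneg (W t)) @^-1` A) =
      Q ((fun t => seq_shift (proj_nonneg (W t))) @^-1` A))
  (Herg : forall A, @cyl_measurable R nat A -> (@seq_shift R) @^-1` A = A ->
      Q ((fun t => proj_nonneg (W t)) @^-1` A) = 0%E \/
      Q ((fun t => proj_nonneg (W t)) @^-1` A) = 1%E).

HB.instance Definition _ := isMeasurableFun.Build _ _ _ _ env_row measurable_env_row.
HB.instance Definition _ := isMeasurableFun.Build _ _ _ _ arrows_row measurable_arrows_row.

Definition stacks (t : T) : (row_space R * row_space R)%type := (env_row t, arrows_row t).

Lemma measurable_stacks : measurable_fun setT stacks.
Proof.
by apply: measurable_fun_pair; [exact: measurable_env_row|exact: measurable_arrows_row].
Qed.

HB.instance Definition _ := isMeasurableFun.Build _ _ _ _ stacks measurable_stacks.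

Definition stack_law : probability _ R := distribution Q stacks.

Definition stack_shift (s : row_space R * row_space R) : (row_space R * row_space R)%type :=
  (seq_shift s.1, seq_shift s.2).

Lemma measurable_stack_shift : measurable_fun setT stack_shift.
Proof.
apply: measurable_fun_pair; apply: measurableT_comp => //; exact: measurable_seq_shift.
Qed.

Lemma stack_lawE A : measurable A ->
  stack_law A = (distribution Q env_row \x distribution Q arrows_row)%E A.
Proof.
move=> mA; apply/esym; apply: product_measure_unique => // A1 A2 mA1 mA2.
exact: env_arrows_indep.
Qed.

Lemma stack_law_shift A : measurable A -> stack_law (stack_shift @^-1` A) = stack_law A.
Proof.
rewrite measurable_prod_measurableType; move: A.
apply: pi_system_law.
- move=> _ _ [A1 mA1 [A2 mA2 <-]] [B1 mB1 [B2 mB2 <-]]; rewrite -setXI.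
  by exists (A1 `&` B1); [exact: measurableI|exists (A2 `&` B2) => //; exact: measurableI].
- move=> _ [A1 mA1 [A2 mA2 <-]]; rewrite -[X in measurable X]setTI.
  by apply: measurable_stack_shift => //; exact: measurableX.
- by move=> _ [A1 mA1 [A2 mA2 <-]]; exact: measurableX.
move=> _ [A1 mA1 [A2 mA2 <-]].
have mS1 : measurable (@seq_shift R @^-1` A1 : set (row_space R)).
  by have := @measurable_seq_shift R measurableT A1 mA1; rewrite setTI.
have mS2 : measurable (@seq_shift R @^-1` A2 : set (row_space R)).
  by have := @measurable_seq_shift R measurableT A2 mA2; rewrite setTI.
rewrite [LHS](env_arrows_indep mS1 mS2) [RHS](env_arrows_indep mA1 mA2).
congr (_ * _)%E; last exact: (arrows_shift_law 1 mA2).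
exact/esym/Hstat.
Qed.

Lemma iter_stack_shift m s :
  iter m stack_shift s = (iter m (@seq_shift R) s.1, iter m (@seq_shift R) s.2).
Proof. by elim: m => [|m IH]; [case: s|rewrite /= IH]. Qed.

(* For a fixed environment a shift-invariant event is a tail event of the rows,
   so its conditional probability is 0 or 1, and the set of environments where
   it is 1 is shift-invariant. *)
Lemma stack_law_ergodic A : measurable A -> stack_shift @^-1` A = A ->
  stack_law A = 0%E \/ stack_law A = 1%E.
Proof.
move=> mA AE.
have AEm m : iter m stack_shift @^-1` A = A.
  elim: m => // m IH; rewrite -[RHS]IH -{2}AE.
  by apply/seteqP; split => s; rewrite /preimage /= -iterS.
pose P2 := distribution Q arrows_row.
pose H : set (row_space R) := [set s | P2 (xsection A s) = 1%E].
have xE m s : xsection A s = iter m (@seq_shift R) @^-1` xsection A (iter m (@seq_shift R) s).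
  have E s2 : A (iter m (@seq_shift R) s, iter m (@seq_shift R) s2) = A (s, s2).
    by rewrite -[in RHS](AEm m) /preimage /= iter_stack_shift.
  by apply/seteqP; split => s2; rewrite /preimage /= !xsectionE /= E.
have z1 s : P2 (xsection A s) = 0%E \/ P2 (xsection A s) = 1%E.
  apply: (@arrows_zero_one _ (fun m => xsection A (iter m (@seq_shift R) s))).
  - exact: measurable_xsection.
  - by move=> m; exact: measurable_xsection.
  - by move=> m; exact: xE.
have mH : measurable H.
  have := measurable_fun_xsection P2 mA.
  move=> /(_ measurableT [set 1%E] (emeasurable_set1 _)); by rewrite setTI.
have HE : @seq_shift R @^-1` H = H.
  apply/seteqP; split => s; rewrite /H /= => <-; rewrite (xE 1%N s) /P2.
  - exact: (arrows_shift_law 1 (measurable_xsection _ mA)).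
  - exact/esym/(arrows_shift_law 1 (measurable_xsection _ mA)).
rewrite stack_lawE// /product_measure1.
rewrite (eq_integral (fun s => (\1_H s)%:E)); last first.
  move=> s _ /=; rewrite indicE; have [h|h] := z1 s.
    rewrite memNset// /H /= -/P2 h => /eqP; by rewrite eq_sym onee_eq0.
  by rewrite mem_set.
rewrite integral_indic// setIT; exact: Herg.
Qed.

(** * Equality in law of the cookie walk and the stacked walk *)

Let UU (t : T) : nat -> R := fun n => U n t.

Lemma joint_preimage_measurable (sg : nat -> nat) A : @joint_gen R A ->
  measurable [set t | A (W t, fun n => U (sg n) t)].
Proof.
move=> [A0 [n [B [mA mB ->]]]].
apply: (measurableI (W @^-1` A0) [set t | forall k : 'I_n, B k (U (sg k) t)]).
  exact: measurable_W.
by apply: measurable_forall => k; exact: measurable_U.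
Qed.

Lemma joint_law (sg : nat -> nat) A : injective sg -> <<s @joint_gen R >> A ->
  Q [set t | A (W t, fun n => U (sg n) t)] = Q [set t | A (W t, UU t)].
Proof.
move=> sgI; move: A; apply: (pi_system_law
  (phi := fun t => (W t, fun n => U (sg n) t)) (psi := fun t => (W t, UU t))).
- exact: setI_closed_joint.
- exact: joint_preimage_measurable.
- exact: (joint_preimage_measurable id).
move=> _ [A0 [n [B [mA mB ->]]]].
have E (f : nat -> nat) : injective f -> Q (W @^-1` A0 `&` [set t | forall k : 'I_n, B k (U (f k) t)]) =
    (Q (W @^-1` A0) * \prod_(k : 'I_n) unif (B k))%E.
  by move=> fI; apply: indep_inj => // i j /fI/val_inj.
by rewrite [LHS](E sg sgI) [RHS](E id (fun x y h => h)).
Qed.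

Lemma first_step_indep B A : measurable B -> <<s @joint_gen R >> A ->
  Q ([set t | B (U 0 t)] `&` [set t | A (W t, fun n => U n.+1 t)]) =
  (unif B * Q [set t | A (W t, UU t)])%E.
Proof.
move=> mB.
have QB : Q [set t | B (U 0 t)] = unif B.
  have := @indep_inj unit (fun=> 0%N) setT (fun=> B) _ (@sigma_setT (env R) _) (fun=> mB).
  rewrite preimage_setT setTI probability_setT mul1e (big_pred1 tt); last by case.
  by move=> <-; [congr (Q _); apply/seteqP; split => t //= /(_ tt)|case=> -[]].
rewrite -QB; move: A; apply: (pi_system_independence
  (phi := fun t => (W t, fun n => U n.+1 t)) (psi := fun t => (W t, UU t))).
- exact: measurable_U.
- exact: setI_closed_joint.
- exact: (joint_preimage_measurable succn).
- exact: (joint_preimage_measurable id).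
move=> _ [A0 [n [C [mA mC ->]]]].
have E : Q (W @^-1` A0 `&` [set t | forall k : 'I_n, C k (U k t)]) =
    (Q (W @^-1` A0) * \prod_(k : 'I_n) unif (C k))%E.
  by apply: (@indep_inj _ (fun k : 'I_n => k : nat)) => //; exact: val_inj.
pose D (k : nat) := if k is m.+1 then C m else B.
have F : Q (W @^-1` A0 `&` [set t | forall k : 'I_n.+1, D k (U k t)]) =
    (Q (W @^-1` A0) * \prod_(k : 'I_n.+1) unif (D k))%E.
  apply: (@indep_inj _ (fun k : 'I_n.+1 => k : nat)) => //; first exact: val_inj.
  by move=> [[|k] ?]; [exact: mB|exact: mC].
rewrite [X in (_ * X)%E]E QB muleCA.
rewrite big_ord_recl /= in F; rewrite -[RHS]F; congr (Q _).
apply/seteqP; split => t /=.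
  move=> [h1 [h2 h3]]; split => // -[[|k] kn] //=.
  exact: (h3 (Ordinal (kn : (k < n)%N))).
move=> [h1 h]; split; first exact: (h ord0).
by split => // k; exact: (h (lift ord0 k)).
Qed.

Definition arrows (t : T) (z : int) (i : nat) : bool := U (pickle (z, i)) t < W t z i.

Let X (t : T) : nat -> int := cwalk (W t) (UU t).
Let X' (t : T) : nat -> int := step_walk (fun=> arrows t).

Let steps_follow (p : nat -> int) n : set (joint_space R) :=
  [set s | p 0%N = 0 /\ forall m, (m < n)%N ->
    p m.+1 = if s.2 m < s.1 (p m) (nvisits p m (p m)).+1 then p m + 1 else p m - 1].

Let measurable_steps_follow p n : measurable (steps_follow p n).
Proof.
apply: measurableI; first exact: measurable_pred.
apply: measurable_forall => m; apply: measurable_implyP; first exact: measurable_pred.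
apply: (measurable_countable_fibre (T := joint_space R)
  (f := fun s => s.2 m < s.1 (p m) (nvisits p m (p m)).+1)
  (fun b => p m.+1 = if b then p m + 1 else p m - 1)) => b.
have := measurable_fun_ltr (@measurable_joint_driving R m)
  (@measurable_joint_env R (p m) (nvisits p m (p m)).+1).
by move=> /(_ measurableT [set b]); rewrite setTI; apply.
Qed.

Let X_prefix p n : X @^-1` [set x | forall m, (m <= n)%N -> x m = p m] =
  [set t | steps_follow p n (W t, UU t)].
Proof.
apply/seteqP; split => t; rewrite /preimage /= /X cwalk_step_walk.
  by move=> /step_walk_prefix.
by move=> h; apply/step_walk_prefix.
Qed.

Let X'_prefix p n : X' @^-1` [set x | forall m, (m <= n)%N -> x m = p m] =
  [set t | steps_follow p n
     (W t, fun m => U (pickle (p m, (nvisits p m (p m)).+1)) t)].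
Proof.
apply/seteqP; split => t; rewrite /preimage /= /X'.
  by move=> /step_walk_prefix.
by move=> h; apply/step_walk_prefix.
Qed.

Lemma measurable_joint_preimage (sg : nat -> nat) A : <<s @joint_gen R >> A ->
  measurable [set t | A (W t, fun n => U (sg n) t)].
Proof.
apply: (preimage_gen_measurable (phi := fun t => (W t, fun n => U (sg n) t))).
exact: joint_preimage_measurable.
Qed.

Let X_gen_measurable A : path_gen A -> measurable (X @^-1` A).
Proof.
move=> [->|[n [p ->]]]; first by rewrite preimage_set0.
rewrite X_prefix; exact: (@measurable_joint_preimage id _ (measurable_steps_follow p n)).
Qed.

Let X'_gen_measurable A : path_gen A -> measurable (X' @^-1` A).
Proof.
move=> [->|[n [p ->]]]; first by rewrite preimage_set0.
rewrite X'_prefix.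
exact: (@measurable_joint_preimage (fun m => pickle (p m, (nvisits p m (p m)).+1)) _
  (measurable_steps_follow p n)).
Qed.

Lemma measurable_walk (A : set path_space) : measurable A -> measurable (X @^-1` A).
Proof. by apply: preimage_gen_measurable; exact: X_gen_measurable. Qed.

Lemma measurable_stacked_walk (A : set path_space) :
  measurable A -> measurable (X' @^-1` A).
Proof. by apply: preimage_gen_measurable; exact: X'_gen_measurable. Qed.

(** Following a prefix [p] imposes the same inequalities on the [U m] for [X] and on the
    [U (pickle (p m, visit number))] for [X']. The latter indices are distinct by [visit_inj], so
    both families have the same joint law with the environment. *)
Lemma walk_law (A : set path_space) : measurable A -> Q (X @^-1` A) = Q (X' @^-1` A).
Proof.
move: A; apply: pi_system_law => //.
- exact: setI_closed_path.
move=> _ [->|[n [p ->]]]; first by rewrite !preimage_set0.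
rewrite X_prefix X'_prefix; apply/esym/joint_law; last exact: measurable_steps_follow.
by move=> m m' /(pcan_inj pickleK)/visit_inj.
Qed.

Lemma ae_measurableP (E : set T) : measurable E ->
  {ae Q, forall t, E t} <-> Q (~` E) = 0%E.
Proof. by move=> mE; apply: negligibleP; exact: measurableC. Qed.

Lemma ae_walk_law (A : set path_space) : measurable A ->
  {ae Q, forall t, A (X t)} <-> {ae Q, forall t, A (X' t)}.
Proof.
move=> mA.
have e1 := ae_measurableP (measurable_walk mA).
have e2 := ae_measurableP (measurable_stacked_walk mA).
have E : Q (~` (X @^-1` A)) = Q (~` (X' @^-1` A)).
  exact: (walk_law (measurableC mA)).
by split=> [/e1|/e2] h; [apply/e2; rewrite -E|apply/e1; rewrite E].
Qed.

Lemma ae_stacks (E : set (row_space R * row_space R)) :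
  {ae stack_law, forall s, E s} -> {ae Q, forall t, E (stacks t)}.
Proof.
move=> [N [mN N0 sN]]; exists (stacks @^-1` N); split => //.
- by have := measurable_stacks measurableT mN; rewrite setTI.
- by move=> t h; apply: sN => h'; exact: h.
Qed.

Lemma ae_eq_probability (A B : set T) : measurable A -> measurable B ->
  {ae Q, forall t, A t <-> B t} -> Q A = Q B.
Proof.
move=> mA mB [N [mN N0 sN]].
have le C D : measurable C -> measurable D ->
    (forall t, (A t <-> B t) -> C t -> D t) -> (Q C <= Q D)%E.
  move=> mC mD CD; apply: (@le_trans _ _ (Q (D `|` N))).
    apply: le_measure; rewrite ?inE//; first exact: measurableU.
    move=> t Ct; have [h|h] := pselect (A t <-> B t); first by left; exact: CD.
    by right; apply: sN.
  have := measureU2 Q mD mN; rewrite [X in (_ + X)%E](_ : _ = 0%E) ?adde0//.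
by apply/eqP; rewrite eq_le !le// => t [].
Qed.

Lemma driving_law n B : measurable B -> Q [set t | B (U n t)] = unif B.
Proof.
move=> mB.
have := @indep_inj unit (fun=> n) setT (fun=> B) _ (@sigma_setT (env R) _) (fun=> mB).
rewrite preimage_setT setTI probability_setT mul1e (big_pred1 tt); last by case.
by move=> <-; [congr (Q _); apply/seteqP; split => t //= /(_ tt)|case=> -[]].
Qed.

(** * Simple random walk as a lower bound *)

Let below (K : int) (n : nat) (x : int) : set (joint_space R) :=
  [set s | forall m, (m <= n)%N -> x + srw s.2 m < K].

Let measurable_below K n x : measurable (below K n x).
Proof.
apply: (measurable_forall (T := joint_space R)) => m.
apply: (measurable_implyP (T := joint_space R)); first exact: measurable_pred.
exact: (measurable_srw m (fun z => x + z < K)).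
Qed.

Let below_prob K n x : \bar R := Q [set t | below K n x (W t, UU t)].

Let below_probS K n x : x < K ->
  (below_prob K n.+1 x = (2^-1)%:E * below_prob K n (x + 1) + (2^-1)%:E * below_prob K n (x - 1))%E.
Proof.
move=> xK.
have mlt := @measurable_lt_half R.
have mge : measurable [set r : R | ~ (r < 2^-1)] by exact: measurableC.
have := first_step_indep mlt (measurable_below K n (x + 1)); rewrite unif_lt_half => <-.
have := first_step_indep mge (measurable_below K n (x - 1)); rewrite unif_ge_half => <-.
have mS y : measurable [set t | below K n y (W t, fun n => U n.+1 t)].
  exact: (measurable_joint_preimage succn (measurable_below K n y)).
rewrite -measureU//; first last.
- by apply/seteqP; split => t //= -[[h _] [h' _]].
- by apply: measurableI => //; exact: measurable_U.
- by apply: measurableI => //; exact: measurable_U.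
congr (Q _); apply/seteqP; split => t /=.
  move=> h; have [lt|ge] := pselect (U 0 t < 2^-1); [left|right]; split => // m mn.
    by have := h m.+1 mn; rewrite srwS /= /UU lt addrA.
  by have := h m.+1 mn; rewrite srwS /= /UU (negbTE (introN idP ge)) addrA.
move=> h [_|m mn]; first by rewrite /srw big_ord0 addr0.
case: h => -[c h]; have := h m mn; rewrite srwS /= /UU.
  by rewrite c addrA.
by rewrite (negbTE (introN idP c)) addrA.
Qed.

(** The probabilities of staying below [K] up to time [n] satisfy the hypotheses of [ruin_cvg0], the
    recursion coming from conditioning on the first step. *)
Lemma ae_srw_unbounded : {ae Q, forall t, forall K : nat, exists n, K%:Z <= srw (UU t) n}.
Proof.
apply: ae_foralln => K.
have mE : measurable [set t | forall n, srw (UU t) n < K%:Z].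
  apply: (measurable_joint_preimage id (A := [set s | forall n, srw s.2 n < K%:Z])).
  apply: (measurable_forall (T := joint_space R)) => n.
  exact: (measurable_srw n (fun z => z < K%:Z)).
pose a n x := fine (below_prob K%:Z n x).
have mB n x : measurable [set t | below K%:Z n x (W t, UU t)].
  exact: (measurable_joint_preimage id (measurable_below K%:Z n x)).
have bE n x : below_prob K%:Z n x = (a n x)%:E.
  by rewrite /a fineK// fin_num_measure.
have a0 : forall x, a n x @[n --> \oo] --> (0 : R).
  apply: (@ruin_cvg0 R K%:Z).
  - move=> n x; rewrite -!lee_fin -bE measure_ge0/=; exact: probability_le1.
  - move=> n x; rewrite -lee_fin -!bE; apply: le_measure; rewrite ?inE//.
    by move=> t h m mn; apply: h; rewrite (leq_trans mn).
  - move=> n x xK; apply: EFin_inj; rewrite -bE below_probS// !bE -!EFinM -EFinD.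
    by congr (_%:E); lra.
  - move=> n x Kx; apply: EFin_inj; rewrite -bE /below_prob.
    rewrite (_ : [set t | _] = set0) ?measure0//.
    apply/seteqP; split => t //= /(_ 0%N isT); rewrite /srw big_ord0 addr0.
    by rewrite ltNge Kx.
exists [set t | forall n, srw (UU t) n < K%:Z]; split => //; last first.
  move=> t /= /forallNP h n; rewrite ltNge; exact/negP.
apply/eqP; rewrite eq_le measure_ge0 andbT; apply/lee_addgt0Pr => e e0; rewrite add0e.
have /cvgrPdist_le/(_ e e0)[N _ hN] := a0 0.
have := hN N (leqnn N); rewrite /= sub0r normrN => h.
apply: (@le_trans _ _ (below_prob K%:Z N 0)).
  apply: le_measure; rewrite ?inE// => t h' m _; rewrite add0r; exact: h'.
by rewrite bE lee_fin (le_trans (ler_norm _)).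
Qed.

Hypothesis Hhalf : forall t z i, (0 < i)%N -> 2^-1 <= W t z i.

Lemma measurable_hits : measurable [set x : path_space | forall j : nat, exists n, x n = j%:Z].
Proof.
apply: (measurable_forall (T := path_space)) => j.
by apply: (measurable_exists (T := path_space)) => n; exact: measurable_path_at.
Qed.

Lemma ae_hits : {ae Q, forall t, forall j : nat, exists n, X t n = j%:Z}.
Proof.
apply: filterS ae_srw_unbounded => t h j; have [n jn] := h j.
have : j%:Z <= X t n by apply: (le_trans jn); apply: srw_le_cwalk; exact: Hhalf.
by rewrite /X cwalk_step_walk; exact: step_walk_hits.
Qed.

(** A one-sided strong law for fair coins, drawn from the ergodic theorem already available on
    stacks: the coins are taken in column 0 of successive rows, and [joint_law] carries the result
    over to the sequence [U] itself. *)
Lemma ae_srw_lower : {ae Q, forall t, forall p : nat, exists N, forall n, (N <= n)%N ->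
  - p.+1%:R^-1 * n%:R <= (srw (UU t) n)%:~R :> R}.
Proof.
apply: ae_foralln => p.
(* With at most [a * n] left steps, [srw] is at least [n - 2 * a * n = - n / (p + 1)]. *)
pose a : R := 2^-1 + p.+1%:R^-1 / 2.
have p0 : 0 < p.+1%:R^-1 :> R by rewrite invr_gt0 ltr0n.
pose E : set (joint_space R) := [set s : env R * (nat -> R) | exists N, forall n, (N <= n)%N ->
  (\sum_(m < n) (2^-1 <= s.2 m)%R)%N%:R <= a * n%:R].
have mcount n : measurable [set s : joint_space R |
    (\sum_(m < n) (2^-1 <= s.2 m)%R)%N%:R <= a * n%:R].
  rewrite (_ : [set s | _] = [set s : joint_space R |
      ((absz (n%:Z - srw s.2 n)%R)./2)%:R <= a * n%:R]).
    exact: (measurable_srw n (fun z => ((absz (n%:Z - z)%R)./2)%:R <= a * n%:R)).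
  apply/seteqP; split => s /=; rewrite srwE; set c := (\sum_(m < n) _)%N;
  by have -> : (absz (n%:Z - (n%:Z - c.*2%:Z))%R)./2 = c by lia.
have mE : measurable E.
  apply: (measurable_exists (T := joint_space R)) => N.
  apply: (measurable_forall (T := joint_space R)) => n.
  by apply: (measurable_implyP (T := joint_space R)); [exact: measurable_pred|exact: mcount].
have QE f : measurable [set t | E (W t, fun n => U (f n) t)].
  exact: (measurable_joint_preimage f mE).
pose sg (i : nat) := pickle (Posz i, 0%N).
have sgI : injective sg by move=> i j /(pcan_inj pickleK)[].
have aeE : {ae Q, forall t, E (W t, fun n => U (sg n) t)}.
  pose f (s : row_space R * row_space R) : R := \1_[set s | 2^-1 <= s.2 0%N 0%N] s.
  have mf : measurable [set s : row_space R * row_space R | 2^-1 <= s.2 0%N 0%N].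
    have := measurable_fun_ler (measurable_cst (2^-1 : R)) (measurableT_comp
      (@measurable_row_at R 0 0) (@measurable_snd _ _ (row_space R) (row_space R))).
    by move=> /(_ measurableT [set true]); rewrite setTI; apply.
  have := @ergodic_limsup _ _ R stack_law stack_shift measurable_stack_shift
    stack_law_shift stack_law_ergodic f a.
  have -> : (\int[stack_law]_s (f s)%:E = (2^-1)%:E)%E.
    rewrite integral_indic// setIT -unif_ge_half -(driving_law (sg 0%N)).
      congr (Q _); apply/seteqP; split => t /=; rewrite /arrows_row.
        by move=> ge; apply/negP; rewrite -leNgt.
      by move=> /negP; rewrite -leNgt.
    exact: (measurableC (@measurable_lt_half R)).
  move=> /(_ (integrable_indic stack_law mf)); rewrite lte_fin ltrDl divr_gt0// => /(_ isT).
  move/ae_stacks; apply: filterS => t [N hN]; exists N => n /hN.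
  apply: le_trans; rewrite /birk natr_sum ler_sum// => i _ /=.
  have <- : (iter i stack_shift (stacks t)).2 0%N 0%N = U (sg i) t.
    by rewrite iter_stack_shift /= iter_seq_shift addn0.
  rewrite /f indicE; case: (boolP (2^-1 <= _)) => [ge|_]; last by [].
  by rewrite mem_set.
have /ae_measurableP : {ae Q, forall t, E (W t, UU t)}.
  apply/(ae_measurableP (QE id)); have /(ae_measurableP (QE sg)) := aeE.
  rewrite !probability_setC//.
  by rewrite (joint_law sgI mE).
move=> /(_ (QE id)) h; have {h} : {ae Q, forall t, E (W t, UU t)} by apply/(ae_measurableP (QE id)).
apply: filterS => t [N hN]; exists N => n /hN /= h.
rewrite srwE rmorphB /= -!pmulrn -muln2 natrM; move: h; rewrite /a.
set c : R := (\sum_(m < n) _)%N%:R; set e : R := p.+1%:R^-1; set m : R := n%:R.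
by nra.
Qed.

(** * Gaps, hitting times and speed *)

Let long (k : nat) : set (row_space R * row_space R) :=
  [set s | ~ short_gap (stack_bits s) k].

Let measurable_long k : measurable (long k).
Proof. exact: (measurableC (@measurable_short_gap R k)). Qed.

Let long_shift t i k : (iter i stack_shift (stacks t) \in long k) =
  ~~ `[< short_gap (fun x => arrows t (Posz (i + x))) k >].
Proof.
have -> : (fun x => arrows t (Posz (i + x))) = stack_bits (iter i stack_shift (stacks t)).
  by apply/funext => x; apply/funext => m; rewrite iter_stack_shift /stack_bits /= !iter_seq_shift.
by rewrite -asbool_neg; apply/idP/asboolP; rewrite inE.
Qed.

Let ae_first_hits : {ae Q, forall t, exists tau, forall j, first_hit (X' t) j (tau j)}.
Proof.
have /(ae_walk_law measurable_hits) := ae_hits; apply: filterS => t h.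
have /choice[tau tauP] : forall j : nat, exists n, first_hit (X' t) j n.
  by move=> j; have [n] := h j; apply: ex_first_hit; exact: step_walk_stack.
by exists tau.
Qed.

Let measurable_gap j : measurable [set x : path_space | gap_event x j].
Proof.
apply: (measurable_forall (T := path_space)) => n.
apply: (measurable_implyP (T := path_space)); first exact: measurable_path_at.
apply: (measurable_exists (T := path_space)) => m; apply: measurableI.
  exact: measurable_path_at.
exact: measurable_pred.
Qed.

(** [short_gap] is read in the stacks, so [X] is first replaced by [X']; the two events are then
    identified on the almost sure event that all sites [j >= 0] are hit. *)
Let gap_prob j : Q [set t | gap_event (X t) j] = stack_law (long j).
Proof.
rewrite (walk_law (measurable_gap j)).
apply: ae_eq_probability.
- exact: (measurable_stacked_walk (measurable_gap j)).
- by have := measurable_stacks measurableT (measurable_long j); rewrite setTI.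
apply: filterS ae_first_hits => t [tau tauP].
have := gap_event_long (step_walk_stack (arrows t)) tauP j.
by rewrite -(long_shift t 0) inE.
Qed.

Let u : \bar R := (\sum_(1 <= j <oo) Q [set t | gap_event (X t) j])%E.

Let uE : u = (\sum_(1 <= k <oo) stack_law (long k))%E.
Proof. by apply: eq_eseriesr => j _; rewrite gap_prob. Qed.

(** The term [j = 1] is already 1, since successive first hits are at least one step apart. *)
Lemma gap_series_ge1 : (1 <= u)%E.
Proof.
have -> : 1%E = Q [set t | gap_event (X t) 1] :> \bar R.
  rewrite (walk_law (measurable_gap 1)) -(probability_setT Q).
  apply: ae_eq_probability => //.
    exact: (measurable_stacked_walk (measurable_gap 1)).
  apply: filterS ae_first_hits => t [tau tauP]; split => // _.
  apply/(gap_eventP (tauP 1%N) (tauP 2)); rewrite addn1.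
  exact: first_hit_leq (tauP 1%N) (tauP 2).
have := @nneseries_lim_ge R (fun j => Q [set t | gap_event (X t) j]) xpredT 1 2.
by rewrite big_nat1; apply => n _ _.
Qed.

Let ae_walk_lower : {ae Q, forall t, forall e : R, 0 < e ->
  exists N, forall n, (N <= n)%N -> - e * n%:R <= (X' t n)%:~R}.
Proof.
pose A : set path_space := [set x | forall p : nat, exists N, forall n, (N <= n)%N ->
  - p.+1%:R^-1 * n%:R <= (x n)%:~R :> R].
have mA : measurable A.
  apply: (measurable_forall (T := path_space)) => p.
  apply: (measurable_exists (T := path_space)) => N.
  apply: (measurable_forall (T := path_space)) => n.
  apply: (measurable_implyP (T := path_space)); first exact: measurable_pred.
  exact: (measurable_path_pred n (fun z => - p.+1%:R^-1 * n%:R <= z%:~R :> R)).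
have /(ae_walk_law mA) : {ae Q, forall t, A (X t)}.
  apply: filterS ae_srw_lower => t h p; have [N hN] := h p; exists N => n /hN le.
  by apply: (le_trans le); rewrite ler_int; apply: srw_le_cwalk; exact: Hhalf.
apply: filterS => t h e e0; have [N hN] := h (Num.Def.archi_bound e^-1).
exists N => n /hN; apply: le_trans; rewrite ler_wpM2r// lerN2.
rewrite -[leRHS]invrK lef_pV2 ?posrE ?invr_gt0 ?ltr0n//.
apply: ltW; apply: (lt_trans (archi_boundP _)); last by rewrite ltr_nat.
by rewrite invr_ge0 ltW.
Qed.

(** Hitting times enter pointwise, as any [tau] with the first-hit property, which avoids treating
    them as random variables. *)
Let ae_hitting_lower : {ae Q, forall t, forall tau,
  (forall j, first_hit (X' t) j (tau j)) -> forall c : R, (c%:E < u)%E ->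
  exists N, forall n, (N <= n)%N -> c * n%:R <= (tau n)%:R}.
Proof.
have := ergodic_count_lower measurable_stack_shift stack_law_shift stack_law_ergodic
  measurable_long.
move/ae_stacks; apply: filterS => t h tau tauP c cu.
have [c' [cc' cu']] : exists c' : R, c < c' /\ (c'%:E < u)%E.
  case: u cu => [r| |] //.
    by rewrite lte_fin => cr; exists ((c + r) / 2); rewrite lte_fin; split; lra.
  by move=> _; exists (c + 1); split; [lra|exact: ltry].
have [K [N hN]] : exists K N, forall n, (N <= n)%N ->
    c' * n%:R <= (\sum_(i < n) \sum_(1 <= k < K.+1)
      (iter i stack_shift (stacks t) \in long k))%N%:R.
  by apply: h; rewrite -uE.
(* [tau_ge_sum_long] is used with [n - K] in place of [n]; the loss [c' * K] is absorbed by
   [(c' - c) * n]. *)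
have [M hM] := @eventually_le_mul R (c' - c) (c' * K%:R) ltac:(lra).
exists (maxn (N + K) M) => n; rewrite geq_max => /andP[Nn Mn].
have Kn : (K <= n)%N by rewrite (leq_trans _ Nn)// leq_addl.
have NnK : (N <= n - K)%N by rewrite leq_subRL// addnC.
apply: (@le_trans _ _ (c' * (n - K)%:R)).
  by have := hM n Mn; rewrite natrB//; set m : R := n%:R; set q : R := K%:R; nra.
apply: (le_trans (hN _ NnK)); rewrite ler_nat.
have := tau_ge_sum_long (step_walk_stack (arrows t)) tauP (n - K) K.
rewrite subnK//; apply: leq_trans; apply: leq_sum => i _.
by apply: leq_sum => k _; rewrite long_shift.
Qed.

Let ae_hitting_upper : {ae Q, forall t, forall tau,
  (forall j, first_hit (X' t) j (tau j)) -> forall c : R, (u < c%:E)%E ->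
  exists N, forall n, (N <= n)%N -> (tau n)%:R <= c * n%:R}.
Proof.
have [uoo|uoo] := ltP u +oo%E; last first.
  apply: aeW => t tau _ c; have -> : u = +oo%E by apply/eqP; rewrite -leye_eq.
  by rewrite ltNge leey.
have uoo' : ((\sum_(1 <= k <oo) stack_law (long k)) < +oo)%E by rewrite -uE.
have := ae_eventually_not measurable_long uoo'; move/ae_stacks.
have := ergodic_count_upper measurable_stack_shift stack_law_shift stack_law_ergodic
  measurable_long uoo'; move/ae_stacks.
apply: filterS2 => t h [J hJ] tau tauP c uc.
have ufin : u \is a fin_num by rewrite ge0_fin_numE// (le_trans _ gap_series_ge1).
have [c' [cc' cu']] : exists c' : R, c' < c /\ (u < c'%:E)%E.
  move: uc; rewrite -(fineK ufin) lte_fin => uc.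
  by exists ((c + fine u) / 2); rewrite lte_fin; split; lra.
have [N hN] : exists N, forall n, (N <= n)%N ->
    (\sum_(i < n) \sum_(1 <= k < n.+1)
      (iter i stack_shift (stacks t) \in long k))%N%:R <= c' * n%:R.
  by apply: h; rewrite -uE.
(* The fixed term [tau J] is absorbed by [(c - c') * n]. *)
have [M hM] := @eventually_le_mul R (c - c') (tau J)%:R ltac:(lra).
exists (maxn (maxn N M) J) => n; rewrite !geq_max => /andP[/andP[Nn Mn] Jn].
have hJ' j : (J <= j)%N -> ~~ ~~ `[< short_gap (fun x => arrows t (Posz (0 + x))) j >].
  by move=> /hJ; rewrite -(long_shift t 0).
have := tau_le_sum_long (step_walk_stack (arrows t)) tauP Jn hJ'.
rewrite -(ler_nat R) natrD => /le_trans; apply.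
apply: (@le_trans _ _ ((tau J)%:R + c' * n%:R)).
  rewrite lerD2l; apply: le_trans (hN n Nn); rewrite ler_nat; apply: leq_sum => i _.
  by apply: leq_sum => k _; rewrite long_shift.
by have := hM n Mn; rewrite mulrBl; lra.
Qed.

Lemma walk_speed : {ae Q, forall t, ((X t n)%:~R / n%:R : R) @[n --> \oo] -->
  (if u is +oo%E then 0 else (fine u)^-1)}.
Proof.
set v := (if u is +oo%E then _ else _).
(* Convergence is written with countable quantifiers, so that it is an event of [path_space] and
   passes from [X'] back to [X] by equality of laws. *)
pose A : set path_space := [set x | forall p : nat, exists N, forall n, (N <= n)%N ->
  `|v - (x n)%:~R / n%:R| <= p.+1%:R^-1].
have mA : measurable A.
  apply: (measurable_forall (T := path_space)) => p.
  apply: (measurable_exists (T := path_space)) => N.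
  apply: (measurable_forall (T := path_space)) => n.
  apply: (measurable_implyP (T := path_space)); first exact: measurable_pred.
  exact: (measurable_path_pred n (fun z => `|v - z%:~R / n%:R| <= p.+1%:R^-1)).
suff /(ae_walk_law mA) : {ae Q, forall t, A (X' t)}.
  by apply: filterS => t /(cvg_inv_nat (fun n => (X t n)%:~R / n%:R) v).
apply: filter_app ae_walk_lower; apply: filter_app ae_hitting_upper.
apply: filter_app ae_hitting_lower; apply: filterS ae_first_hits => t [tau tauP] low up lim.
apply: (proj1 (cvg_inv_nat (fun n => (X' t n)%:~R / n%:R) v)).
exact: (stack_walk_speed (step_walk_stack (arrows t)) tauP gap_series_ge1
  (low tau tauP) (up tau tauP) lim).
Qed.

End driven.

Theorem mainTheorem13 (R : realType) (d : measure_display) (T : measurableType d)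
  (Q : probability T R) (W : T -> env R) (U : nat -> T -> R)
  (* the environment omega = W and the driving variables U_n are random variables *)
  (HWmeas : forall z i, measurable_fun setT (fun t => W t z i))
  (HUmeas : forall n, measurable_fun setT (U n))
  (* omega takes values in Omega_+ *)
  (Hsupp : forall t z i, (0 < i)%N -> 2^-1 <= W t z i <= 1)
  (* omega, U_0, U_1, ... independent, U_k uniform on [0,1] *)
  (Hindep : forall (A : set (env R)) (n : nat) (B : nat -> set R),
      @cyl_measurable R int A -> (forall k, measurable (B k)) ->
      Q (W @^-1` A `&` \bigcap_(k in [set k | (k < n)%N]) (U k @^-1` B k)) =
      (Q (W @^-1` A) * \prod_(k < n) lebesgue_measure (B k `&` `[0%R, 1%R]))%E)
  (* (omega(x))_{x >= 0} is stationary ... *)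
  (Hstat : forall A, @cyl_measurable R nat A ->
      Q ((fun t => proj_nonneg (W t)) @^-1` A) =
      Q ((fun t => seq_shift (proj_nonneg (W t))) @^-1` A))
  (* ... and ergodic *)
  (Herg : forall A, @cyl_measurable R nat A -> (@seq_shift R) @^-1` A = A ->
      Q ((fun t => proj_nonneg (W t)) @^-1` A) = 0%E \/
      Q ((fun t => proj_nonneg (W t)) @^-1` A) = 1%E) :
  let X := fun t => cwalk (W t) (fun n => U n t) in
  let u := (\sum_(1 <= j <oo) Q [set t | gap_event (X t) j])%E in
  let v : R := if u is +oo%E then 0 else (fine u)^-1 in
  (1 <= u)%E /\
  \forall t \ae Q, ((X t n)%:~R / n%:R : R) @[n --> \oo] --> v.
Proof.
have Hhalf t z i : (0 < i)%N -> 2^-1 <= W t z i by move=> /(Hsupp t z)/andP[].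
split; first exact: (gap_series_ge1 HWmeas HUmeas Hindep Hhalf).
exact: (walk_speed HWmeas HUmeas Hindep Hstat Herg Hhalf).
Qed.
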